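(* Let $f$ be a transcendental entire function for which there exists $r>0$ such that $m^n(r)\to\infty$ as $n\to\infty$, where $m(\rho)=\min\{|f(z)|:|z|=\rho\}$ for $\rho\ge 0$ and $m^n$ denotes the $n$th iterate of the function $\rho\mapsto m(\rho)$. Then the set $I^{+}(f)=\{z\in\mathbb{C}:(f^n(z))_{n\in\mathbb{N}}\text{ is unbounded}\}$ is connected.
   Context: $f^n$ denotes the $n$th iterate of $f$. A transcendental entire function is an entire function that is not a polynomial. *)

(* Defs.v *)
From HB Require Import structures.
From mathcomp Require Export all_boot all_order all_algebra.
From mathcomp Require Export all_classical all_reals all_analysis.
From mathcomp Require Export complex.
Import Order.TTheory GRing.Theory Num.Theory.
Import numFieldNormedType.Exports.
Set Implicit Arguments.
Unset Strict Implicit.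
Unset Printing Implicit Defensive.
Local Open Scope classical_set_scope.
Local Open Scope ring_scope.
Local Open Scope complex_scope.

(* [R[i]^o] is [R[i]] with the topology and the complex normed-module structure
   given by the modulus, so [derivable f z 1] is complex differentiability. *)
Definition entire (R : realType) (f : R[i]^o -> R[i]^o) : Prop :=
  forall z : R[i]^o, derivable f z 1.

Definition transcendental_entire (R : realType) (f : R[i]^o -> R[i]^o) : Prop :=
  entire f /\ ~ (exists p : {poly R[i]}, forall z : R[i], f z = p.[z]).

(* The modulus [`|z|] lives in [R[i]], with zero imaginary part; by
   [min_modulusP] below the infimum is a minimum. *)
Definition min_modulus (R : realType) (f : R[i]^o -> R[i]^o) (rho : R) : R :=
  inf [set complex.Re `|f z| | z in [set z : R[i]^o | `|z| = rho%:C]].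

Definition unbounded_orbits (R : realType) (f : R[i]^o -> R[i]^o) :
    set R[i]^o :=
  [set z | ~ bounded_fun (fun n : nat => iter n f z)].

Lemma min_modulusP (R : realType) (f : R[i]^o -> R[i]^o) (rho : R) :
  entire f -> 0 <= rho ->
  let A := [set complex.Re `|f z| | z in [set z : R[i]^o | `|z| = rho%:C]] in
  A (min_modulus f rho) /\ lbound A (min_modulus f rho).
Proof.
move=> fE rho0 A.
pose c (t : R) : R[i]^o := (rho * cos t) +i* (rho * sin t).
have cont_c : continuous c.
  have Im_bound (z : R[i]) : `|z| <= (`|complex.Re z| + `|complex.Im z|)%:C.
    rewrite normc_def lecR -[leRHS]ger0_norm ?addr_ge0// -sqrtr_sqr.
    rewrite ler_wsqrtr// sqrrD !real_normK ?num_real//.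
    by rewrite addrAC lerDl mulrn_wge0// mulr_ge0.
  move=> t; apply/cvgrPdist_lt => e e0.
  have [eR er] : 0 < complex.Re e /\ e = (complex.Re e)%:C.
    by case: e e0 => a b; rewrite ltcE /= => /andP[/eqP b0 a0]; split; rewrite // b0.
  rewrite er; have e2 : 0 < complex.Re e / 2 by rewrite divr_gt0.
  have /cvgrPdist_lt/(_ _ e2) C : (rho * cos x) @[x --> t] --> rho * cos t.
    by apply: cvgMl_tmp; exact: continuous_cos.
  have /cvgrPdist_lt/(_ _ e2) S : (rho * sin x) @[x --> t] --> rho * sin t.
    by apply: cvgMl_tmp; exact: continuous_sin.
  near=> x; apply: le_lt_trans (Im_bound _) _.
  rewrite ltcR [ltRHS]splitr /= ltrD//; first by near: x.
  by near: x.
pose h t := complex.Re `|f (c t)|.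
have cont_h : continuous h.
  move=> t; apply/cvgrPdist_lt => e e0.
  have fc : {for t, continuous (f \o c)}.
    apply: continuous_comp; first exact: cont_c.
    exact/differentiable_continuous/derivable1_diffP/fE.
  have e0' : 0 < e%:C :> R[i] by rewrite ltcR.
  move/cvgrPdist_lt : fc => /(_ _ e0') F.
  near=> x; rewrite -ltcR.
  apply: le_lt_trans (_ : `|(f \o c) t - (f \o c) x| < _); last by near: x.
  apply: le_trans (ler_dist_dist _ _).
  by rewrite /h -raddfB; exact: normc_ge_Re.
have [t _ tmin] : exists2 t : R, t \in `[- pi, pi] &
    forall s, s \in `[- pi, pi] -> h t <= h s.
  apply: EVT_min; first by rewrite (@le_trans _ _ 0) ?oppr_le0 ?pi_ge0.
  exact: continuous_subspaceT.
have cA s : A (h s).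
  exists (c s) => //=; rewrite normc_def /= !exprMn -mulrDr cos2Dsin2 mulr1.
  by rewrite sqrtr_sqr ger0_norm.
have lbA : lbound A (h t).
  move=> _ [[a b] /= abr <-].
  have {abr} abr : a ^+ 2 + b ^+ 2 = rho ^+ 2.
    move: abr; rewrite normc_def => -[<-] /=.
    by rewrite sqr_sqrtr// addr_ge0 ?sqr_ge0.
  have [r0|rN0] := eqVneq rho 0.
    have -> : a +i* b = c 0.
      move: abr; rewrite r0 expr0n /= => /eqP.
      rewrite paddr_eq0 ?sqr_ge0// !sqrf_eq0 => /andP[/eqP -> /eqP ->].
      by rewrite /c r0 !mul0r.
    by apply: tmin; rewrite in_itv /= oppr_le0 pi_ge0.
  have rp : 0 < rho by rewrite lt_def rN0.
  pose u := a / rho.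
  have u1 : -1 <= u <= 1.
    rewrite -ler_norml -(@ler_pXn2r _ 2)// ?nnegrE// expr1n real_normK ?num_real//.
    rewrite expr_div_n ler_pdivrMr ?exprn_gt0// mul1r -abr lerDl; exact: sqr_ge0.
  have aE : a = rho * u by rewrite /u mulrCA divff// mulr1.
  have bE : rho * Num.sqrt (1 - u ^+ 2) = `|b|.
    rewrite -{1}(ger0_norm rho0) -sqrtr_sqr -sqrtrM ?sqr_ge0//.
    rewrite mulrBr mulr1 -exprMn -aE -abr addrAC subrr add0r.
    by rewrite sqrtr_sqr.
  have p0 := acos_ge0 u1; have ppi := acos_lepi u1.
  have [b0|b0] := leP 0 b.
    have -> : a +i* b = c (acos u).
      by rewrite /c acosK ?in_itv// sin_acos// bE ger0_norm// -aE.
    apply: tmin; rewrite in_itv /= ppi andbT.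
    by rewrite (le_trans _ p0)// oppr_le0 pi_ge0.
  have -> : a +i* b = c (- acos u).
    rewrite /c cosN sinN acosK ?in_itv// sin_acos// mulrN bE ltr0_norm//.
    by rewrite opprK -aE.
  apply: tmin; rewrite in_itv /= lerN2 ppi /=.
  by rewrite (@le_trans _ _ 0)// ?oppr_le0// pi_ge0.
have -> : min_modulus f rho = h t.
  apply/eqP; rewrite eq_le; apply/andP; split.
    by apply: ge_inf; [exists (h t)|exact: cA].
  by apply: lb_le_inf => //; exists (h t); exact: cA.
by [].
Unshelve. all: by end_near. Qed.

(* Main.v *)
(* Write [s n] for the iterates of the minimum modulus, and let [K_M] be the
   compact set of the points whose orbit stays in the disc of radius [M]; the
   complement of the set of unbounded orbits is the union of the [K_M].  As [f]
   maps the circle of radius [s n] outside the disc of radius [s n.+1], a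
   connected set that meets [K_t] and lies in some [K_M] already lies in [K_u],
   where [u] depends only on [t].  Hence every continuum of points with bounded
   orbits lies in a single [K_M]: otherwise a decreasing sequence of continua
   with this defect, the n-th one disjoint from [K_n], would meet in a point with
   unbounded orbit.
   The maximum principle for the iterates shows that a point [a] outside [K_M]
   can be joined to infinity there, so [z - a] has a continuous argument around
   [K_M].  Suppose now that disjoint open sets [U] and [V] cover the unbounded
   orbits and meet them at [a] and [b], and let [F] be the complement of their
   union.  Every continuum in [F] lies in some [K_M], so each point of [F] has a
   compact relatively open neighbourhood in [F] on which [(z - b) / (z - a)] has
   a continuous argument; patched together and extended by Tietze's theorem, this
   argument is used to rotate [z - a] on [V] into a field without zeros that
   agrees with [z - b] on [U], on [F] and near infinity, which is impossible for
   winding number reasons. *)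
Require Import Defs.
From mathcomp Require Import ring lra.
Import Order.TTheory GRing.Theory Num.Theory.
Import numFieldNormedType.Exports.
Set Implicit Arguments.
Unset Strict Implicit.
Unset Printing Implicit Defensive.
Local Open Scope classical_set_scope.
Local Open Scope ring_scope.

(** * Components of compact sets *)

(** In a compact set components are quasi-components. Every open set around the quasi-component [Q]
    contains one of the relatively clopen sets that define it, so a splitting of [Q] would yield a
    smaller such set around [p] missing part of [Q]. *)
Lemma component_clopen_nbhs (R : realType) (T : pseudoMetricType R)
    (Z O : set T) (p : T) :
  hausdorff_space T -> compact Z -> Z p -> open O ->
  connected_component Z p `<=` O ->
  exists W, [/\ open W, W p, closed (Z `&` W) & Z `&` W `<=` O].
Proof.
move=> hT cZ Zp.
have clZ : closed Z by exact: compact_closed.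
pose cl := [set W | [/\ open W, W p & closed (Z `&` W)]].
have clI A B : cl A -> cl B -> cl (A `&` B).
  move=> [oA Ap cA] [oB Bp cB]; split=> //; first exact: openI.
  by rewrite -(setIid Z) setIACA; exact: closedI.
have clT : cl setT by split=> //; [exact: openT|rewrite setIT].
pose Q := \bigcap_(W in cl) (Z `&` W).
have Qp : Q p by move=> W [].
have clQ : closed Q by apply: closed_bigI => W [].
have shrink O' : open O' -> Q `<=` O' -> exists2 W, cl W & Z `&` W `<=` O'.
  move=> oO' QO'; apply: contrapT => /forall2NP noW.
  pose F := filter_from cl (fun W => (Z `&` W) `\` O').
  have FF : ProperFilter F.
    apply: filter_from_proper.
      apply: filter_from_filter; first by exists setT.
      move=> A B cA cB; exists (A `&` B); first exact: clI.
      by move=> x [[Zx [Ax Bx]] nO]; split; split.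
    move=> W cW; have [//|/existsNP[x /not_implyP[ZWx nO]]] := noW W.
    by exists x.
  have FZ : F Z by exists setT => // x [[]].
  have [x [Zx Fx]] := cZ F FF FZ.
  have Qx : Q x.
    move=> W cW; have [_ _ cZW] := cW.
    apply: cZW.
    have : F ((Z `&` W) `\` O') by exists W.
    move: Fx; rewrite clusterE => /[apply]; apply: closureS.
    by move=> y [].
  have : (~` O') x.
    apply: (open_closedC oO').
    have : F (Z `\` O') by exists setT => // y [[]].
    by move: Fx; rewrite clusterE => /[apply]; apply: closureS => y [].
  by apply; exact: QO'.
have conQ : connected Q.
  apply/connectedP => E [E0 EU sE].
  wlog E0p : E E0 EU sE / E false p.
    move=> G; have := Qp; rewrite EU => -[E0c|E1c]; first exact: (G E).
    by apply: (G (E \o negb)) => //;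
      [case => /=|rewrite EU setUC|rewrite separatedC].
  have clE b : closed (E b).
    move=> x cx; have : Q x.
      apply: clQ; apply: closureS cx.
      by rewrite EU; case: b => y; [right|left].
    rewrite EU; case: sE => s1 s2; case: b cx => cx [|]// ex.
      by have : (E false `&` closure (E true)) x by []; rewrite s2.
    by have : (closure (E false) `&` E true) x by []; rewrite s1.
  have /(@normal_openP R T) nT := @pseudometric_normal R T.
  have [U0 [U1 [oU0 oU1 EU0 EU1 U01]]] :=
    nT _ _ (clE false) (clE true) (separated_disjoint sE).
  have [|W [oW Wp cW] ZWU] := shrink (U0 `|` U1) (openU oU0 oU1).
    by rewrite EU => x [/EU0|/EU1]; [left|right].
  have clU0 : cl (W `&` U0).
    split; [exact: openI|by split=> //; exact: EU0|].
    rewrite (_ : _ `&` _ = (Z `&` W) `&` ~` U1).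
      by apply: closedI => //; exact: open_closedC.
    apply/seteqP; split=> x.
      move=> [Zx [Wx U0x]]; split => // U1x.
      by have : (U0 `&` U1) x by []; rewrite U01.
    move=> [[Zx Wx] nU1]; split=> //; split=> //.
    by have [] := ZWU x.
  have [y Ey] := E0 true; have : Q y by rewrite EU; right.
  move=> /(_ _ clU0) [_ [_ U0y]].
  have : (U0 `&` U1) y by split => //; exact: EU1.
  by rewrite U01.
move=> oO compO; have [|W [oW Wp cW] ZWO] := shrink O oO.
  by apply: subset_trans compO; apply: connected_component_max => // x /(_ _ clT)[].
by exists W.
Qed.

(** Boundary bumping: a component away from [closure O] would have a clopen neighbourhood in the
    complement of [O] that avoids [closure O], hence is clopen in all of [E]. *)
Lemma component_meets_boundary (R : realType) (T : pseudoMetricType R)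
    (E O : set T) (q : T) :
  hausdorff_space T -> compact E -> connected E -> open O ->
  E q -> ~ O q -> E `&` O !=set0 ->
  connected_component (E `\` O) q `&` closure O !=set0.
Proof.
move=> hT cE conE oO Eq nOq [y [Ey Oy]].
apply: contrapT => /nonemptyPn/disjoints_subset compO.
have cEO : compact (E `\` O).
  apply: (subclosed_compact _ cE); last by move=> x [].
  by apply: closedI; [exact: compact_closed|exact: open_closedC].
have [||W [oW Wq cW WO]] := component_clopen_nbhs hT cEO _ _ compO.
- by split.
- exact/closed_openC/closed_closure.
have EWE : E `&` (W `&` ~` closure O) = (E `\` O) `&` W.
  apply/seteqP; split=> x.
    by move=> [Ex [Wx nO]]; split=> //; split=> // Ox; apply: nO; exact: subset_closure.
  by move=> [[Ex nO] Wx]; split=> //; split=> //; apply: WO.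
have : (E `\` O) `&` W = E.
  apply: conE; first by exists q; split.
    exists (W `&` ~` closure O); last by rewrite EWE.
    by apply: openI => //; exact/closed_openC/closed_closure.
  exists ((E `\` O) `&` W) => //.
  by apply/seteqP; split=> [x [[Ex nO] Wx]//|x [_ []]].
move/seteqP => [_ /(_ y Ey)] [[_ nOy]].
by move=> _; exact: nOy.
Qed.

(** * Continua of bounded orbits *)

Definition orbits_le (R : realType) (T : Type) (N : T -> R) (f : T -> T)
    (M : R) : set T :=
  [set z | forall n, N (iter n f z) <= M].

(** The order of quantifiers is the point: [u] is fixed before [E] and [M], so any bound at all
    improves to one depending on [t] only. The margin [t + 1 <= u] leaves room for the
    neighbourhoods in [unbounded_subcontinuum]. *)
Definition orbits_rigid (R : realType) (T : topologicalType) (N : T -> R)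
    (f : T -> T) : Prop :=
  forall t, exists2 u, t + 1 <= u &
    forall (E : set T) M, connected E -> E `<=` orbits_le N f M ->
      E `&` orbits_le N f t !=set0 -> E `<=` orbits_le N f u.

Lemma connected_level (R : realType) (T : topologicalType) (g : T -> R)
    (E : set T) (p q : T) (t : R) :
  connected E -> continuous g -> E p -> E q -> g p <= t <= g q ->
  exists2 w, E w & g w = t.
Proof.
move=> cE cg Ep Eq pq.
have /connected_intervalP itv : connected (g @` E).
  by apply: connected_continuous_connected => //; exact: continuous_subspaceT.
have gp : (g @` E) (g p) by exists p.
have gq : (g @` E) (g q) by exists q.
by have [w Ew gw] := itv _ _ gp gq t pq; exists w.
Qed.

Lemma iter_continuous (T : topologicalType) (f : T -> T) n :
  continuous f -> continuous (iter n f).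
Proof.
move=> cf; elim: n => [|n IH] z; first exact: cvg_id.
by apply: (@continuous_comp _ _ _ (iter n f) f); [exact: IH|exact: cf].
Qed.

Lemma iter_norm_continuous (R : realType) (T : topologicalType) (N : T -> R)
    (f : T -> T) n :
  continuous N -> continuous f -> continuous (fun z => N (iter n f z)).
Proof.
move=> cN cf z.
by apply: (@continuous_comp _ _ _ (iter n f) N); [exact: iter_continuous|exact: cN].
Qed.

Lemma closed_sublevel (R : realType) (T : topologicalType) (g : T -> R) M :
  continuous g -> closed [set z | g z <= M].
Proof.
move=> cg; rewrite (_ : [set _ | _] = g @^-1` [set x | x <= M])//.
by apply: closed_comp => [z _|]; [exact: cg|exact: closed_le].
Qed.

Lemma open_sublevel (R : realType) (T : topologicalType) (g : T -> R) M :
  continuous g -> open [set z | g z < M].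
Proof.
move=> cg; rewrite (_ : [set _ | _] = g @^-1` [set x | x < M])//.
by apply: open_comp => [z _|]; [exact: cg|exact: open_lt].
Qed.

Lemma closed_orbits_le (R : realType) (T : topologicalType) (N : T -> R)
    (f : T -> T) M :
  continuous N -> continuous f -> closed (orbits_le N f M).
Proof.
move=> cN cf.
rewrite (_ : orbits_le _ _ _ = \bigcap_n [set z | N (iter n f z) <= M]).
  by apply: closed_bigI => n _; apply: closed_sublevel; exact: iter_norm_continuous.
by apply/seteqP; split=> z; [move=> h n _; exact: h|move=> h n; exact: h].
Qed.

Lemma orbits_le_mono (R : realType) (T : Type) (N : T -> R) (f : T -> T) M M' :
  M <= M' -> orbits_le N f M `<=` orbits_le N f M'.
Proof. by move=> MM' z h n; exact: le_trans (h n) MM'. Qed.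

(* A connected set that escapes [s k] at some time keeps meeting the levels
   [s k.+1], [s k.+2], ... at the following times. *)
Lemma min_modulus_orbits_rigid (R : realType) (T : topologicalType) (N : T -> R)
    (f : T -> T) (s : nat -> R) :
  continuous N -> continuous f -> s n @[n --> \oo] --> +oo ->
  (forall n z, N z = s n -> s n.+1 <= N (f z)) ->
  orbits_rigid N f.
Proof.
move=> cN cf soo sf t.
move/cvgryPge : soo => soo.
have [k _ kP] := soo (t + 1).
exists (s k); first exact: kP (leqnn k).
move=> E M conE EM [p [Ep pt]] q Eq n; rewrite leNgt; apply/negP => qn.
have esc j : exists2 z, E z & s (k + j)%N <= N (iter (n + j) f z).
  elim: j => [|j [z Ez zj]]; first by exists q => //; rewrite !addn0 ltW.
  have [|||||w Ew wj] := @connected_level _ _ (fun z => N (iter (n + j) f z)) E p z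
    (s (k + j)%N) => //.
  - exact: iter_norm_continuous.
  - rewrite zj andbT (le_trans (pt _))// (le_trans _ (kP (k + j)%N (leq_addr _ _)))//.
    by rewrite lerDl.
  by exists w => //; rewrite !addnS iterS; exact: sf.
have [m _ mP] := soo (M + 1).
have [z Ez zm] := esc m.
have := le_trans (mP (k + m)%N (leq_addl _ _)) (le_trans zm (EM z Ez _)).
by rewrite leNgt ltrDl ltr01.
Qed.

Lemma closed_nested_compact (T : topologicalType) (Z : set T) (C : nat -> set T) :
  compact Z -> (forall n, closed (C n)) -> (forall n, C n `<=` Z) ->
  (forall n, C n !=set0) -> (forall n, C n.+1 `<=` C n) ->
  \bigcap_n C n !=set0.
Proof.
move=> cZ clC CZ C0 Cdec.
have Cmono m n : (m <= n)%N -> C n `<=` C m.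
  elim: n => [|n IH]; first by rewrite leqn0 => /eqP ->.
  rewrite leq_eqVlt => /predU1P[->//|]; rewrite ltnS => /IH.
  by apply: subset_trans; exact: Cdec.
pose F := filter_from [set: nat] C.
have FF : ProperFilter F.
  apply: filter_from_proper => //.
  apply: filter_from_filter; first by exists 0%N.
  move=> i j _ _; exists (maxn i j) => // x Cx.
  by split; apply: Cmono Cx; [exact: leq_maxl|exact: leq_maxr].
have [|x [_ Fx]] := cZ F FF; first by exists 0%N => //; exact: CZ.
exists x => n _; apply: clC; move: Fx; rewrite clusterE; apply.
by exists n.
Qed.

Lemma open_orbit_prefix (R : realType) (T : topologicalType) (N : T -> R)
    (f : T -> T) (c : R) m :
  continuous N -> continuous f ->
  open [set z | forall i, (i <= m)%N -> N (iter i f z) < c].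
Proof.
move=> cN cf; elim: m => [|m IH].
  rewrite (_ : [set _ | _] = [set z | N z < c]); first exact: open_sublevel.
  apply/seteqP; split=> z /= h; first exact: (h 0%N).
  by move=> i; rewrite leqn0 => /eqP ->.
rewrite (_ : [set _ | _] = [set z | forall i, (i <= m)%N -> N (iter i f z) < c]
    `&` [set z | N (iter m.+1 f z) < c]).
  by apply: openI => //; apply: open_sublevel; exact: iter_norm_continuous.
apply/seteqP; split=> z /=.
  by move=> h; split=> [i im|]; [exact: h (leqW im)|exact: (h m.+1)].
by move=> [h1 h2] i; rewrite leq_eqVlt => /predU1P[->//|]; exact: h1.
Qed.

(** Shrinking neighbourhoods [V n] of the level [r] are cut out of [E], keeping the component [C n]
    of a point [q] whose orbit exceeds [u]. If every [C n] had bounded orbits, the closure of their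
    union would touch level [r], and rigidity would hold [q] below [u]. *)
Lemma unbounded_subcontinuum (R : realType) (T : pseudoMetricType R)
    (N : T -> R) (f : T -> T) (E : set T) (r : R) :
  hausdorff_space T -> continuous N -> continuous f ->
  orbits_rigid N f ->
  compact E -> connected E -> E `<=` \bigcup_M orbits_le N f M ->
  (forall M, ~ E `<=` orbits_le N f M) ->
  exists E1, [/\ compact E1, connected E1, E1 `<=` E,
    (forall M, ~ E1 `<=` orbits_le N f M) & E1 `&` orbits_le N f r = set0].
Proof.
move=> hT cN cf dich cE conE EK Ebad.
have clE : closed E by exact: compact_closed.
have [[p [Ep pr]]|/nonemptyPn E0] := pselect (E `&` orbits_le N f r !=set0); last first.
  by exists E; split.
have [u ru dr] := dich r.
have [q [Eq qu]] : exists q, E q /\ ~ orbits_le N f u q.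
  by have /existsNP[q /not_implyP[Eq qu]] := Ebad u; exists q.
have [j jq] : exists j, u < N (iter j f q).
  by move/existsNP : qu => [j /negP]; rewrite -ltNge; exists j.
pose eps n : R := n.+1%:R^-1.
have eps_dec n : eps n.+1 <= eps n by rewrite lef_pV2 ?posrE// ler_nat.
have eps1 n : eps n <= 1 by rewrite invf_le1// ler1n.
(* Only finitely many times are constrained, so [V n] is open. Time [j] is among them and
   [r + eps n <= r + 1 <= u], so [q] lies outside every [V n]. *)
pose V n := [set z | forall i, (i <= j + n)%N -> N (iter i f z) < r + eps n].
pose L n := [set z | forall i, (i <= n)%N -> N (iter i f z) <= r + eps n].
have oV n : open (V n) by exact: open_orbit_prefix.
have clL n : closed (L n).
  rewrite (_ : L n = \bigcap_(i in [set i | (i <= n)%N])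
      [set z | N (iter i f z) <= r + eps n]).
    by apply: closed_bigI => i _; apply: closed_sublevel; exact: iter_norm_continuous.
  by apply/seteqP; split=> z h i; exact: h.
have VL n : closure (V n) `<=` L n.
  rewrite (closure_id (L n)).1//; apply: closureS => z Vz i im.
  by rewrite ltW// Vz// (leq_trans im)// leq_addl.
have nVq n : ~ V n q.
  move=> /(_ j (leq_addr _ _)); apply/negP; rewrite -leNgt.
  by rewrite (le_trans _ (ltW jq))// (le_trans _ ru)// lerD2l.
pose C n := connected_component (E `\` V n) q.
have Cq n : C n q by apply: connected_component_refl; split.
have CE n : C n `<=` E by move=> z /connected_component_sub[].
have conC n : connected (C n) by exact: component_connected.
have clC n : closed (C n).
  by apply: component_closed; apply: closedI => //; exact: open_closedC.
have CV n : C n `&` closure (V n) !=set0.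
  apply: component_meets_boundary => //.
  exists p; split => // i _; rewrite (le_lt_trans (pr i))// ltrDl.
  by rewrite invr_gt0 ltr0n.
have [[n Cbad]|noC] := pselect (exists n, forall M, ~ C n `<=` orbits_le N f M).
  exists (C n); split=> //; first exact: subclosed_compact (CE n).
  apply/seteqP; split=> // z [/connected_component_sub[_ nV] zr]; apply: nV.
  by move=> i _; rewrite (le_lt_trans (zr i))// ltrDl invr_gt0 ltr0n.
exfalso.
have Cgood n : exists M, C n `<=` orbits_le N f M.
  move/forallNP : noC => /(_ n)/existsNP[M /contrapT CM]; by exists M.
have [t _ qt] := EK _ Eq.
(* All the [C n] contain [q], so rigidity at its level [t] replaces their separate bounds by the
   common bound [v]. *)
have [v tv dt] := dich t.
pose S := closure (\bigcup_n C n).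
have conS : connected S.
  by apply: connected_closure; apply: bigcup_connected => //; exists q => n _.
have Sv : S `<=` orbits_le N f v.
  rewrite (closure_id (orbits_le N f v)).1; last exact: closed_orbits_le.
  apply: closureS => z [n _ Cz]; have [M CM] := Cgood n.
  by apply: (dt _ M (conC n) CM) Cz; exists q.
have SE : S `<=` E.
  by rewrite (closure_id E).1//; apply: closureS => z [n _]; exact: CE.
(* Boundary bumping makes each [C n] reach [L n]; a point common to all the [L n] has its whole
   orbit at level at most [r]. *)
have [z Sz] : \bigcap_n (S `&` L n) !=set0.
  apply: (closed_nested_compact cE).
  - by move=> n; apply: closedI => //; exact: closed_closure.
  - by move=> n z [/SE].
  - move=> n; have [z [Cz Vz]] := CV n; exists z; split; last exact: VL.
    by apply: subset_closure; exists n.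
  - move=> n z [Sz Lz]; split=> // i im.
    by rewrite (le_trans (Lz i (leqW im)))// lerD2l.
suff : orbits_le N f u q by [].
apply: (dr _ v conS Sv); last by apply: subset_closure; exists 0%N.
exists z; split; first by have [] := Sz 0%N.
move=> i; apply/ler_addgt0Pr => e e0.
have [n en] : exists n, r + eps n < r + e by apply: ltr_add_invr; rewrite ltrDl.
have [_ /(_ i)] := Sz (maxn i n) I.
rewrite leq_maxl => /(_ isT) h; rewrite (le_trans h)// (le_trans _ (ltW en))//.
by rewrite lerD2l lef_pV2 ?posrE// ler_nat ltnS leq_maxr.
Qed.

Lemma continuum_orbits_bounded (R : realType) (T : pseudoMetricType R)
    (N : T -> R) (f : T -> T) (E : set T) :
  hausdorff_space T -> continuous N -> continuous f ->
  orbits_rigid N f ->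
  compact E -> connected E -> E `<=` \bigcup_M orbits_le N f M ->
  exists M, E `<=` orbits_le N f M.
Proof.
move=> hT cN cf dich cE conE EK; apply: contrapT => /forallNP Ebad.
pose bad (A : set T) := [/\ compact A, connected A, A `<=` E &
  forall M, ~ A `<=` orbits_le N f M].
have step (A : {A | bad A}) n : exists B : {B | bad B}, sval B `<=` sval A /\
    sval B `&` orbits_le N f n%:R = set0.
  case: A => A [cA conA AE Abad].
  have [|B [cB conB BA Bbad B0]] :=
    unbounded_subcontinuum n%:R hT cN cf dich cA conA _ Abad.
    exact: subset_trans EK.
  have bB : bad B by split=> //; exact: subset_trans AE.
  by exists (exist _ B bB).
pose next A n := sval (cid (step A n)).
have bE : bad E by split.
pose A := fix A n := if n is n'.+1 then next (A n') n' else exist _ E bE.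
have AS n : sval (A n.+1) `<=` sval (A n) by exact: (svalP (cid (step (A n) n))).1.
have A0 n : sval (A n.+1) `&` orbits_le N f n%:R = set0.
  exact: (svalP (cid (step (A n) n))).2.
have [z zA] : \bigcap_n (sval (A n)) !=set0.
  apply: (closed_nested_compact cE) => // n; case: (A n) => B [cB conB BE Bbad] //=.
  - exact: compact_closed.
  - apply/set0P/eqP => B0; apply: (Bbad 0).
    by rewrite B0.
have [M _ zM] := EK z (zA 0%N I).
have [n Mn] : exists n : nat, M <= n%:R.
  by exists (Num.bound `|M|); rewrite (le_trans (ler_norm _))// ltW// archi_boundP.
have : (sval (A n.+1) `&` orbits_le N f n%:R) z.
  by split; [exact: zA|exact: orbits_le_mono zM].
by rewrite A0.
Qed.

(** * Winding of planar vector fields *)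

Definition dot (R : realType) (w w' : R * R) : R := w.1 * w'.1 + w.2 * w'.2.
Definition cross (R : realType) (w w' : R * R) : R := w.1 * w'.2 - w.2 * w'.1.

(* The signed angle from [w] to [w'], meaningful when [0 < dot w w']. *)
Definition dang (R : realType) (w w' : R * R) : R := atan (cross w w' / dot w w').

Definition is_angle (R : realType) (w : R * R) (a : R) : Prop :=
  exists2 r, 0 < r & w = (r * cos a, r * sin a).

Lemma for_continuous_comp (R S T : topologicalType) (g : S -> T) (f : R -> S) x :
  {for x, continuous f} -> {for f x, continuous g} ->
  {for x, continuous (fun z => g (f z))}.
Proof. exact: continuous_comp. Qed.

Lemma for_continuous_fst (S T U : topologicalType) (f : S -> T * U) x :
  {for x, continuous f} -> {for x, continuous (fun z => (f z).1)}.
Proof. by move=> cf; apply: (for_continuous_comp (g := fst)) => //; exact: cvg_fst. Qed.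

Lemma for_continuous_snd (S T U : topologicalType) (f : S -> T * U) x :
  {for x, continuous f} -> {for x, continuous (fun z => (f z).2)}.
Proof. by move=> cf; apply: (for_continuous_comp (g := snd)) => //; exact: cvg_snd. Qed.

Lemma for_continuous_pair (S T U : topologicalType) (f : S -> T) (g : S -> U) x :
  {for x, continuous f} -> {for x, continuous g} ->
  {for x, continuous (fun z => (f z, g z))}.
Proof. by move=> cf cg; exact: cvg_pair. Qed.

Lemma for_continuous_id (T : topologicalType) (x : T) :
  {for x, continuous (fun z : T => z)}.
Proof. exact: cvg_id. Qed.

Lemma dot_cvg (R : realType) (T : topologicalType) (f g : T -> R * R) (x : T) :
  {for x, continuous f} -> {for x, continuous g} ->
  {for x, continuous (fun z => dot (f z) (g z))}.
Proof.
move=> cf cg; apply: cvgD; apply: cvgM.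
- exact: (for_continuous_fst cf).
- exact: (for_continuous_fst cg).
- exact: (for_continuous_snd cf).
- exact: (for_continuous_snd cg).
Qed.

Lemma cross_cvg (R : realType) (T : topologicalType) (f g : T -> R * R) (x : T) :
  {for x, continuous f} -> {for x, continuous g} ->
  {for x, continuous (fun z => cross (f z) (g z))}.
Proof.
move=> cf cg; apply: cvgB; apply: cvgM.
- exact: (for_continuous_fst cf).
- exact: (for_continuous_snd cg).
- exact: (for_continuous_snd cf).
- exact: (for_continuous_fst cg).
Qed.

Lemma dang_cvg (R : realType) (T : topologicalType) (f g : T -> R * R) (x : T) :
  {for x, continuous f} -> {for x, continuous g} -> dot (f x) (g x) != 0 ->
  {for x, continuous (fun z => dang (f z) (g z))}.
Proof.
move=> cf cg d0; apply: (for_continuous_comp (g := atan)); last exact: continuous_atan.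
by apply: cvgM; [exact: cross_cvg|apply: cvgV => //; exact: dot_cvg].
Qed.

(** The values of [atan] lie strictly between [- (pi / 2)] and [pi / 2], so the cosine of
    [dang w w'] is positive and its tangent determines the sine; the addition formulas give the
    direction of [w']. *)
Lemma is_angle_dang (R : realType) (w w' : R * R) a :
  is_angle w a -> 0 < dot w w' -> is_angle w' (a + dang w w').
Proof.
move=> [r r0 wE] d0.
set t := cross w w' / dot w w'.
have k0 : 0 < cos (dang w w').
  by rewrite cos_gt0_pihalf// atan_gtNpi2 atan_ltpi2.
have sE : sin (dang w w') = t * cos (dang w w').
  by rewrite -[t]atanK /tan mulfVK// gt_eqF.
have tE : t * dot w w' = cross w w' by rewrite mulfVK// gt_eqF.
(* The length of [w'], recovered from its projection on [w]. *)
exists (dot w w' / (r * cos (dang w w'))).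
  by rewrite divr_gt0// mulr_gt0.
rewrite cosD sinD sE {sE}; move: (cos (dang w w')) k0 => k k0.
have -> : dot w w' / (r * k) * (cos a * k - sin a * (t * k)) =
    (dot w w' * cos a - sin a * cross w w') / r.
  by rewrite -tE; field; rewrite !gt_eqF.
have -> : dot w w' / (r * k) * (sin a * k + cos a * (t * k)) =
    (dot w w' * sin a + cos a * cross w w') / r.
  by rewrite -tE; field; rewrite !gt_eqF.
have c2 := cos2Dsin2 a.
rewrite [LHS]surjective_pairing /dot /cross wE /=; congr (_, _).
  apply: (@mulIf _ r); first by rewrite gt_eqF.
  rewrite mulfVK ?gt_eqF//; transitivity (w'.1 * r * (cos a ^+ 2 + sin a ^+ 2)).
    by rewrite c2 mulr1.
  ring.
apply: (@mulIf _ r); first by rewrite gt_eqF.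
rewrite mulfVK ?gt_eqF//; transitivity (w'.2 * r * (cos a ^+ 2 + sin a ^+ 2)).
  by rewrite c2 mulr1.
ring.
Qed.

(** Each sign pattern offers a coordinate vector of known angle that makes an acute angle with
    [w]. *)
Lemma is_angle_exists (R : realType) (w : R * R) : w != 0 -> exists a, is_angle w a.
Proof.
move=> w0.
have base (v : R * R) a : v = (cos a, sin a) -> is_angle v a.
  by move=> ->; exists 1 => //; rewrite !mul1r.
have [w1|w1|w1] := ltgtP w.1 0.
- exists (pi + dang (-1, 0) w); apply: is_angle_dang; last by rewrite /dot/=; lra.
  by apply: base; rewrite cospi sinpi.
- exists (0 + dang (1, 0) w); apply: is_angle_dang; last by rewrite /dot/=; lra.
  by apply: base; rewrite cos0 sin0.
have [w2|w2|w2] := ltgtP w.2 0.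
- exists (- (pi / 2) + dang (0, -1) w); apply: is_angle_dang; last by rewrite /dot/=; lra.
  by apply: base; rewrite cosN sinN cos_pihalf sin_pihalf.
- exists (pi / 2 + dang (0, 1) w); apply: is_angle_dang; last by rewrite /dot/=; lra.
  by apply: base; rewrite cos_pihalf sin_pihalf.
by move/eqP : w0; case; rewrite [LHS]surjective_pairing w1 w2.
Qed.

Lemma is_angle_Dpi (R : realType) (w : R * R) a :
  is_angle w a -> ~ is_angle w (a + pi).
Proof.
move=> [r r0 ->] [r' r'0 []]; rewrite cosDpi sinDpi => c s.
have : (r + r') * cos a = 0 by lra.
have : (r + r') * sin a = 0 by lra.
have rr : r + r' != 0 by rewrite gt_eqF// addr_gt0.
move=> /eqP; rewrite mulf_eq0 (negbTE rr)/= => /eqP s0.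
move=> /eqP; rewrite mulf_eq0 (negbTE rr)/= => /eqP c0.
by have := cos2Dsin2 a; rewrite s0 c0; lra.
Qed.

Lemma dot_gt0 (R : realType) (w : R * R) : w != 0 -> 0 < dot w w.
Proof.
move=> w0; rewrite lt_def addr_ge0 -?expr2 ?sqr_ge0// andbT.
rewrite paddr_eq0 ?sqr_ge0// !sqrf_eq0; apply: contra w0 => /andP[/eqP h1 /eqP h2].
by rewrite [w]surjective_pairing h1 h2.
Qed.

(** The total turning [W r] of the field along the circle of radius [r] varies continuously from 0
    to [pi *+ 2], so it takes the value [pi]; but the field returns to its initial value after a
    full turn, which [is_angle_Dpi] excludes. *)
Lemma no_retraction (R : realType) (phi : R * R -> R * R) (b : R * R) (rho : R) :
  0 < rho -> continuous phi -> (forall z, phi z != 0) ->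
  (forall t, phi (b.1 + rho * cos t, b.2 + rho * sin t) = (cos t, sin t)) ->
  False.
Proof.
move=> rho0 cphi phi0 phiE.
pose psi (p : R * R) := phi (b.1 + p.1 * cos p.2, b.2 + p.1 * sin p.2).
have cpsi : continuous psi.
  move=> p; apply: (for_continuous_comp (g := phi)); last exact: cphi.
  have c1 := for_continuous_fst (@for_continuous_id _ p).
  have c2 := for_continuous_snd (@for_continuous_id _ p).
  apply: for_continuous_pair; (apply: cvgD; first exact: cvg_cst); apply: cvgM => //.
    by apply: (for_continuous_comp (g := cos)) => //; exact: continuous_cos.
  by apply: (for_continuous_comp (g := sin)) => //; exact: continuous_sin.
have psi0 p : psi p != 0 by exact: phi0.
pose K : set (R * R) := `[0, rho] `*` `[0, pi *+ 2].
have cK : compact K by apply: compact_setX; exact: segment_compact.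
(* Compactness gives one angular step for all radii such that consecutive field vectors make an
   acute angle. *)
have : \forall h \near (0 : R), forall p, K p ->
    0 < dot (psi p) (psi (p.1, p.2 + h)).
  move/compact_near_coveringP : cK => /(_ _ (nbhs (0:R)) (fun h p =>
    0 < dot (psi p) (psi (p.1, p.2 + h)))) /=; apply.
  move=> p _.
  have : {for (p, 0 : R), continuous (fun q : (R * R) * R =>
      dot (psi q.1) (psi (q.1.1, q.1.2 + q.2)))}.
    have c1 := for_continuous_fst (@for_continuous_id _ (p, 0 : R)).
    apply: dot_cvg; first exact: for_continuous_comp c1 (cpsi _).
    apply: (for_continuous_comp (g := psi)); last exact: cpsi.
    apply: for_continuous_pair; first exact: for_continuous_fst.
    apply: cvgD; first exact: for_continuous_snd.
    exact: (for_continuous_snd (@for_continuous_id _ (p, 0 : R))).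
  rewrite /prop_for /continuous_at /= addr0 -surjective_pairing => h.
  exact: cvgr_gt h _ (dot_gt0 (psi0 p)).
move=> /nbhs_ballP[e /= e0 he].
(* At least five steps make [h < pi / 2], where [atan] inverts [tan]. *)
have [n [n5 ne]] : exists n, (5 <= n)%N /\ (pi *+ 2) / n%:R < e.
  exists (Num.bound (pi *+ 2 / e) + 5)%N; split; first exact: leq_addl.
  have pe : 0 <= pi *+ 2 / e by rewrite divr_ge0 ?(ltW e0)// mulrn_wge0// pi_ge0.
  rewrite ltr_pdivrMr ?ltr0n ?addn_gt0 ?orbT// mulrC -ltr_pdivrMr//.
  by rewrite (lt_le_trans (archi_boundP pe))// ler_nat leq_addr.
have n0 : (0 : R) < n%:R by rewrite ltr0n (leq_trans _ n5).
pose h := (pi *+ 2) / n%:R : R.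
have nh : n%:R * h = pi *+ 2 by rewrite mulrC divfK// gt_eqF.
have h0 : 0 < h by rewrite divr_gt0// mulrn_wgt0// pi_gt0.
have hpi : h < pi / 2.
  have : 5%:R * h <= n%:R * h by rewrite ler_pM2r// ler_nat.
  have := pi_gt0 R; rewrite nh; lra.
have dpos r j : 0 <= r <= rho -> (j < n)%N ->
    0 < dot (psi (r, j%:R * h)) (psi (r, j.+1%:R * h)).
  move=> rr jn.
  have -> : j.+1%:R * h = j%:R * h + h by rewrite -addn1 natrD mulrDl mul1r.
  apply: (he h _ (r, j%:R * h)); first by rewrite /ball/= sub0r normrN gtr0_norm.
  split; rewrite /= in_itv//= mulr_ge0 ?ler0n ?(ltW h0)//=.
  by rewrite -nh ler_pM2r// ler_nat ltnW.
pose W r := \sum_(j < n) dang (psi (r, j%:R * h)) (psi (r, j.+1%:R * h)).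
have cW r : 0 <= r <= rho -> {for r, continuous W}.
  move=> rr; rewrite /W; apply: cvg_big => [|j _]; first exact: add_continuous.
  have cp (x : R) : {for r, continuous (fun r => psi (r, x))}.
    apply: (for_continuous_comp (g := psi)); last exact: cpsi.
    by apply: for_continuous_pair; [exact: for_continuous_id|exact: cvg_cst].
  apply: (dang_cvg (f := fun r => psi (r, j%:R * h))
    (g := fun r => psi (r, j.+1%:R * h)) (x := r)) => //.
  by rewrite gt_eqF// dpos.
have W0 : W 0 = 0.
  rewrite /W big1// => j _.
  have p0 x : psi (0, x) = phi b.
    by rewrite /psi /= !mul0r !addr0 -surjective_pairing.
  by rewrite !p0 /dang /cross [X in X - _]mulrC subrr mul0r atan0.
have Wrho : W rho = pi *+ 2.
  rewrite /W (eq_bigr (fun=> h)); first by rewrite sumr_const card_ord -mulr_natl nh.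
  move=> j _; rewrite /psi /= !phiE /dang /cross /dot /=.
  have -> : j.+1%:R * h = j%:R * h + h by rewrite -addn1 natrD mulrDl mul1r.
  set x := _ * h.
  have c2 := cos2Dsin2 x.
  have -> : cos x * sin (x + h) - sin x * cos (x + h) = sin h.
    by rewrite sinD cosD -[RHS]mul1r -c2; ring.
  have -> : cos x * cos (x + h) + sin x * sin (x + h) = cos h.
    by rewrite sinD cosD -[RHS]mul1r -c2; ring.
  by rewrite tanK// in_itv/= hpi andbT (lt_trans _ h0)// oppr_lt0 divr_gt0 ?pi_gt0.
have pi2 : pi <= pi *+ 2 :> R by rewrite mulr2n lerDl pi_ge0.
have [r rr Wr] : exists2 r, r \in `[0, rho] & W r = pi.
  apply: IVT; first exact: ltW.
    by apply: continuous_in_subspaceT => r; rewrite inE /= in_itv /=; exact: cW.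
  by rewrite W0 Wrho min_l ?max_r ?pi_ge0// mulrn_wge0// pi_ge0.
rewrite in_itv /= in rr.
have [a ha] := is_angle_exists (psi0 (r, 0)).
have step m : (m <= n)%N -> is_angle (psi (r, m%:R * h))
    (a + \sum_(j < m) dang (psi (r, j%:R * h)) (psi (r, j.+1%:R * h))).
  elim: m => [|m IH] mn; first by rewrite big_ord0 addr0 mul0r.
  rewrite big_ord_recr /= addrA; apply: is_angle_dang; last exact: dpos.
  exact/IH/ltnW.
have := step n (leqnn n); rewrite -/(W r) Wr nh.
have -> : psi (r, pi *+ 2) = psi (r, 0).
  by rewrite /psi /= cos2pi sin2pi cos0 sin0.
exact: is_angle_Dpi.
Qed.

(** * Cauchy-Goursat and the maximum principle *)

Definition l1 (R : realType) (h : R * R) : R := `|h.1| + `|h.2|.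

Definition cmul (R : realType) (c h : R * R) : R * R :=
  (c.1 * h.1 - c.2 * h.2, c.2 * h.1 + c.1 * h.2).

(** Complex differentiability in real coordinates: the linear part is complex multiplication by [c],
    for which the norm [l1] is submultiplicative. *)
Definition cderiv (R : realType) (g : R * R -> R * R) (z c : R * R) : Prop :=
  forall e, 0 < e -> exists2 d : R, 0 < d &
    forall h, l1 h <= d -> l1 (g (z + h) - g z - cmul c h) <= e * l1 h.

Definition holomorphic (R : realType) (g : R * R -> R * R) : Prop :=
  forall z, exists c, cderiv g z c.

Lemma l1_ge0 (R : realType) (h : R * R) : 0 <= l1 h.
Proof. exact: addr_ge0. Qed.

Lemma l1D (R : realType) (h k : R * R) : l1 (h + k) <= l1 h + l1 k.
Proof. by rewrite /l1 addrACA lerD// ler_normD. Qed.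

Lemma l1_cmul (R : realType) (h k : R * R) : l1 (cmul h k) <= l1 h * l1 k.
Proof.
rewrite /l1 /cmul /= mulrDl !mulrDr -!normrM.
apply: le_trans (lerD (ler_normB _ _) (ler_normD _ _)) _; lra.
Qed.

Lemma l1_continuous (R : realType) : continuous (@l1 R).
Proof.
move=> z; apply: cvgD; apply: cvg_norm.
  exact: for_continuous_fst (@for_continuous_id _ z).
exact: for_continuous_snd (@for_continuous_id _ z).
Qed.

Lemma cderiv_comp (R : realType) (g k : R * R -> R * R) z c c' :
  cderiv g z c -> cderiv k (g z) c' -> cderiv (k \o g) z (cmul c' c).
Proof.
move=> gc kc e e0.
(* The bound 1 controls the increment [q]; the remainder of [k] at [q] and the image under [cmul c']
   of the remainder of [g] each take half of [e]. *)
pose e1 := Num.min 1 (e / 2 / (l1 c' + 1)).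
have c'0 : 0 < l1 c' + 1 by rewrite ltr_wpDl// l1_ge0.
have c0 : 0 < l1 c + 1 by rewrite ltr_wpDl// l1_ge0.
have e10 : 0 < e1 by rewrite lt_min ltr01/= !divr_gt0.
pose e2 := e / 2 / (l1 c + 1).
have e20 : 0 < e2 by rewrite !divr_gt0.
have [d1 d10 gd] := gc _ e10.
have [d2 d20 kd] := kc _ e20.
exists (Num.min d1 (d2 / (l1 c + 1))); first by rewrite lt_min d10/= divr_gt0.
move=> h; rewrite le_min => /andP[h1 h2].
have := gd h h1; set r := g (z + h) - g z - cmul c h => rh.
have gE : g (z + h) = g z + (cmul c h + r).
  by rewrite /r; ring.
rewrite /= gE; set q := cmul c h + r.
have q1 : l1 q <= (l1 c + 1) * l1 h.
  rewrite (le_trans (l1D _ _))// mulrDl lerD ?l1_cmul// (le_trans rh)//.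
  by rewrite ler_wpM2r ?l1_ge0// ge_min lexx.
have {}kd := kd q; have {}h2 : l1 q <= d2.
  by rewrite (le_trans q1)// mulrC -ler_pdivlMr.
have {}kd := kd h2.
have -> : k (g z + q) - k (g z) - cmul (cmul c' c) h =
    (k (g z + q) - k (g z) - cmul c' q) + cmul c' r.
  by rewrite /q; apply/pair_equal_spec; split; rewrite /=; ring.
rewrite (le_trans (l1D _ _))// [leRHS](_ : _ = e / 2 * l1 h + e / 2 * l1 h).
  apply: lerD.
    rewrite (le_trans kd)//; rewrite (le_trans (ler_wpM2l (ltW e20) q1))//.
    by rewrite mulrA /e2 divfK// gt_eqF.
  rewrite (le_trans (l1_cmul _ _))// (le_trans (ler_wpM2l (l1_ge0 _) rh))//.
  rewrite mulrA ler_wpM2r ?l1_ge0//.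
  have : e1 <= e / 2 / (l1 c' + 1) by rewrite ge_min lexx orbT.
  rewrite ler_pdivlMr// mulrC mulrDl mul1r => h3.
  by rewrite (le_trans _ h3)// lerDl ltW.
by field.
Qed.

Lemma cderiv_continuous (R : realType) (g : R * R -> R * R) z c :
  cderiv g z c -> {for z, continuous g}.
Proof.
move=> gc; have [d d0 gd] := gc _ ltr01.
have cl : {for z, continuous (fun w : R * R => l1 (w - z))}.
  apply: (for_continuous_comp (g := @l1 R) (f := fun w : R * R => w - z)); last exact: l1_continuous.
  by apply: cvgB; [exact: cvg_id|exact: cvg_cst].
have l0 : l1 (z - z) = 0 by rewrite subrr /l1 normr0 addr0.
rewrite /prop_for /continuous_at l0 in cl.
apply/cvgrPdist_le => /= e e0.
have c0 : 0 < l1 c + 1 by rewrite ltr_wpDl// l1_ge0.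
have : 0 < Num.min d (e / (l1 c + 1)) by rewrite lt_min d0 divr_gt0.
move=> /(cvgr_lt _ cl); apply: filterS => w.
rewrite lt_min => /andP[/ltW wd /ltW we].
have /= := gd _ wd; rewrite [z + _]addrC subrK mul1r => h.
have : l1 (g w - g z) <= e.
  have -> : g w - g z = (g w - g z - cmul c (w - z)) + cmul c (w - z) by rewrite subrK.
  rewrite (le_trans (l1D _ _))// (le_trans (lerD h (l1_cmul _ _)))//.
  by rewrite -[X in X + _]mul1r -mulrDl mulrC [1 + _]addrC -ler_pdivlMr.
move=> h'; rewrite -normrN opprB.
rewrite prod_normE /= ge_max; apply/andP; split; apply: le_trans h'.
  by rewrite lerDl.
by rewrite lerDr.
Qed.

Lemma holomorphic_continuous (R : realType) (g : R * R -> R * R) :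
  holomorphic g -> continuous g.
Proof. by move=> hg z; have [c] := hg z; exact: cderiv_continuous. Qed.

Lemma holomorphic_iter (R : realType) (g : R * R -> R * R) n :
  holomorphic g -> holomorphic (iter n g).
Proof.
move=> hg; elim: n => [|n IH] z.
  exists (1, 0) => e e0; exists 1 => // h _.
  have -> : iter 0 g (z + h) - iter 0 g z - cmul (1, 0) h = 0.
    by apply/pair_equal_spec; split; rewrite /=; ring.
  by rewrite {1}/l1 normr0 addr0 mulr_ge0 ?l1_ge0// ltW.
have [c hc] := IH z; have [c' hc'] := hg (iter n g z).
exists (cmul c' c); exact: (cderiv_comp hc hc').
Qed.

(** The field is left general because both real and complex derivatives are expanded this way. *)
Lemma derivable_expansion (K : numFieldType) (f : K^o -> K^o) (x : K^o) :
  derivable f x 1 -> forall e : K, 0 < e ->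
  exists2 d : K, 0 < d &
    forall h, `|h| <= d -> `|f (x + h) - f x - 'D_1 f x * h| <= e * `|h|.
Proof.
move=> dfx e e0.
have : h^-1 *: ((f \o shift x) (h *: 1) - f x) @[h --> 0^'] --> 'D_1 f x by exact: dfx.
move/cvgrPdist_le => /(_ _ e0); rewrite /dnbhs /within /= => /nbhs_ballP[d /= d0 hd].
exists (d / 2); first by rewrite divr_gt0.
move=> h hd2.
have [->|h0] := eqVneq h 0; first by rewrite addr0 subrr mulr0 subr0 normr0 mulr0.
have := hd h; rewrite /ball /= sub0r normrN => /(_ _ h0) H.
have {}H := H (le_lt_trans hd2 _).
have -> : f (x + h) - f x - 'D_1 f x * h =
    - (('D_1 f x - h^-1 *: (f (h *: 1 + x) - f x)) * h).
  rewrite [h *: 1]mulr1 [h + x]addrC [h^-1 *: _]mulrC mulrBl mulfVK// opprB.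
  by [].
rewrite normrN normrM ler_wpM2r// H// ltr_pdivrMr// mulr_natr mulr2n ltrDl//.
Qed.

Lemma is_derive_expansion (R : realType) (f : R -> R) (x l : R) :
  is_derive x 1 f l -> forall e, 0 < e ->
  exists2 d : R, 0 < d & forall h, `|h| <= d -> `|f (x + h) - f x - l * h| <= e * `|h|.
Proof.
by move=> [dfx <-] e e0; exact: (derivable_expansion dfx).
Qed.

(** The complex exponential, from logarithm of the radius and angle to the plane. *)
Definition polar (R : realType) (w : R * R) : R * R :=
  (expR w.1 * cos w.2, expR w.1 * sin w.2).

Lemma polarD (R : realType) (w h : R * R) : polar (w + h) = cmul (polar w) (polar h).
Proof.
rewrite /polar /cmul /= expRD cosD sinD.
by apply/pair_equal_spec; split; ring.
Qed.

(** The functional equation [polarD] reduces the estimate to the origin, where it compares the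
    exponential of [h] with 1 + h. *)
Lemma polar_cderiv (R : realType) (w : R * R) : cderiv (@polar R) w (polar w).
Proof.
move=> e e0.
have p0 : 0 < l1 (polar w) + 1 by rewrite ltr_wpDl// l1_ge0.
(* The error terms [t1] to [t5] below total at most 2 e1 |x| + 6 e1 |y|, so the factor 12 is
   ample. *)
have [e1 [e10 e11 e1e]] : exists e1, [/\ 0 < e1, e1 <= 1 & e1 <= e / (l1 (polar w) + 1) / 12].
  exists (Num.min 1 (e / (l1 (polar w) + 1) / 12)).
  by rewrite lt_min ltr01/= !divr_gt0// !ge_min !lexx orbT.
have [d1 d10 hd1] := is_derive_expansion (is_derive_expR 0) e10.
have [d2 d20 hd2] := is_derive_expansion (is_derive_cos 0) e10.
have [d3 d30 hd3] := is_derive_expansion (is_derive_sin 0) e10.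
exists (Num.min e1 (Num.min d1 (Num.min d2 d3))).
  by rewrite !lt_min e10 d10 d20 d30.
move=> h; rewrite !le_min => /and4P[he h1 h2 h3].
have -> : polar (w + h) - polar w - cmul (polar w) h =
    cmul (polar w) (polar h - (1, 0) - h).
  by rewrite polarD /cmul; apply/pair_equal_spec; split; rewrite /=; ring.
rewrite (le_trans (l1_cmul _ _))//.
suff : l1 (polar h - (1, 0) - h) <= 12 * e1 * l1 h.
  move=> H; rewrite (le_trans (ler_wpM2l (l1_ge0 _) H))// mulrA ler_wpM2r ?l1_ge0//.
  move: e1e; rewrite ler_pdivlMr// ler_pdivlMr// => H1; rewrite (le_trans _ H1)//.
  have := l1_ge0 (polar w); nra.
have a1 : `|h.1| <= l1 h by rewrite lerDl.
have a2 : `|h.2| <= l1 h by rewrite lerDr.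
have := hd1 h.1 (le_trans a1 h1); rewrite add0r expR0 mul1r => E1.
have := hd2 h.2 (le_trans a2 h2); rewrite add0r cos0 sin0 oppr0 mul0r subr0 => E2.
have := hd3 h.2 (le_trans a2 h3); rewrite add0r sin0 cos0 subr0 mul1r => E3.
rewrite /l1 /polar /= !subr0.
have -> : expR h.1 * cos h.2 - 1 - h.1 =
    (expR h.1 - 1 - h.1) * cos h.2 + (1 + h.1) * (cos h.2 - 1) by ring.
have -> : expR h.1 * sin h.2 - h.2 =
    expR h.1 * (sin h.2 - h.2) + (expR h.1 - 1 - h.1) * h.2 + h.1 * h.2 by ring.
move: E1 E2 E3 a1 a2 he; rewrite /l1.
set x := h.1; set y := h.2; set E := expR x - 1 - x; set C := cos y - 1.
set S := sin y - y => E1 E2 E3 a1 a2 he.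
have x1 : `|x| <= 1 by lra.
have bx : `|1 + x| <= 2 by rewrite (le_trans (ler_normD _ _))// normr1; lra.
have be : `|expR x| <= 3.
  have -> : expR x = E + (1 + x) by rewrite /E; ring.
  rewrite (le_trans (ler_normD _ _))//.
  have : e1 * `|x| <= 1 by rewrite mulr_ile1// ltW.
  lra.
have bc : `|cos y| <= 1 by rewrite ler_norml cos_geN1 cos_le1.
have t1 : `|E * cos y| <= e1 * `|x|.
  by rewrite normrM (le_trans (ler_pM _ _ E1 bc))// mulr1.
have t2 : `|(1 + x) * C| <= 2 * (e1 * `|y|) by rewrite normrM ler_pM.
have t3 : `|expR x * S| <= 3 * (e1 * `|y|) by rewrite normrM ler_pM.
have t4 : `|E * y| <= e1 * `|x|.
  rewrite normrM (le_trans (ler_pM (normr_ge0 _) (normr_ge0 _) E1 (_ : `|y| <= 1)))//.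
    lra.
  by rewrite mulr1.
have t5 : `|x * y| <= e1 * `|y|.
  by rewrite normrM ler_wpM2r//; lra.
have n1 := ler_normD (E * cos y) ((1 + x) * C).
have n2 := ler_normD (expR x * S + E * y) (x * y).
have n3 := ler_normD (expR x * S) (E * y).
have z1 : 0 <= e1 * `|x| by rewrite mulr_ge0// ltW.
have z2 : 0 <= e1 * `|y| by rewrite mulr_ge0// ltW.
lra.
Qed.

(** * Rectangle integrals and Goursat's theorem *)

Lemma antiderivative (R : realType) (a : R) (h : R -> R) :
  continuous h -> exists H : R -> R, forall x, a < x -> is_derive x 1 H (h x).
Proof.
move=> ch.
(* The integral starts at [a], so its derivative is obtained only to the right of [a]; hence the
   conditions [a < x] below. *)
exists (fun y => \int[lebesgue_measure]_(t in [set` `[a, y]]) (h t))%R => x ax.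
have [||||d1 d2] := @continuous_FTC1_closed R h a x (x + 1).
- by rewrite ltrDl.
- apply: continuous_compact_integrable; first exact: segment_compact.
  exact: continuous_subspaceT.
- by [].
- exact: ch.
by rewrite derive1E in d2; exact: DeriveDef d1 d2.
Qed.

(** An integral estimate expressed by primitives: the mean value theorem is applied to [F] minus the
    quadratic primitive of [A + B * x]. *)
Lemma increment_le (R : realType) (F p : R -> R) (x1 x2 : R) (A B e : R) :
  x1 <= x2 ->
  (forall x, x1 <= x <= x2 -> is_derive x 1 F (p x)) ->
  (forall x, x1 <= x <= x2 -> `|p x - (A + B * x)| <= e) ->
  `|F x2 - F x1 - (A * (x2 - x1) + B * (x2 ^+ 2 - x1 ^+ 2) / 2)| <= e * (x2 - x1).
Proof.
move=> x12 dF pe.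
pose G x := F x - (A * x + B / 2 * (x * x)).
have dG x : x1 <= x <= x2 -> is_derive x 1 G (p x - (A + B * x)).
  move=> /dF dFx; have dM := is_deriveM (is_derive_id x 1) (is_derive_id x 1).
  have dA := is_deriveZ A (is_derive_id x 1).
  have dN := is_deriveB dFx (is_deriveD dA (is_deriveZ (B / 2) dM)).
  by apply: (is_derive_eq dN); rewrite /GRing.scale /=; field.
have [c cx] : exists2 c, c \in `[x1, x2] & G x2 - G x1 = (p c - (A + B * c)) * (x2 - x1).
  apply: (MVT_segment x12) => [x|].
    by rewrite in_itv /= => /andP[h1 h2]; apply: dG; rewrite !ltW.
  apply: derivable_within_continuous => x.
  by rewrite in_itv /= => xx; have [] := dG x xx.
have -> : F x2 - F x1 - (A * (x2 - x1) + B * (x2 ^+ 2 - x1 ^+ 2) / 2) = G x2 - G x1.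
  by rewrite /G; field.
move=> ->; rewrite normrM (ger0_norm (_ : 0 <= x2 - x1)) ?subr_ge0//.
by rewrite ler_wpM2r ?subr_ge0// pe//; move: cx; rewrite in_itv.
Qed.

(* [circ P Q x1 x2 y1 y2] is the integral of [v dx + u dy] along the boundary of
   [x1, x2] x [y1, y2] when [P y] and [Q x] are primitives of [v(., y)] and
   [u(x, .)]. *)
Definition circ (R : realType) (P Q : R -> R -> R) (x1 x2 y1 y2 : R) : R :=
  (P y1 x2 - P y1 x1) + (Q x2 y2 - Q x2 y1)
  - (P y2 x2 - P y2 x1) - (Q x1 y2 - Q x1 y1).

Lemma circ_split (R : realType) (P Q : R -> R -> R) (x1 x2 x3 y1 y2 y3 : R) :
  circ P Q x1 x3 y1 y3 = circ P Q x1 x2 y1 y2 + circ P Q x2 x3 y1 y2 +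
    circ P Q x1 x2 y2 y3 + circ P Q x2 x3 y2 y3.
Proof. by rewrite /circ; ring. Qed.

(** Here [circ] is the imaginary part of the integral of g dz. The affine approximation of [g] at
    [z] contributes nothing, by the Cauchy-Riemann equations, and on each side the error is at most
    [e * w] times its length. *)
Lemma circ_small (R : realType) (g : R * R -> R * R) (a : R) (P Q : R -> R -> R)
    (z c : R * R) :
  (forall y x, a < x -> is_derive x 1 (P y) (g (x, y)).2) ->
  (forall x y, a < y -> is_derive y 1 (Q x) (g (x, y)).1) ->
  cderiv g z c -> forall e, 0 < e -> exists2 d : R, 0 < d &
  forall x1 x2 y1 y2, a < x1 -> a < y1 -> x1 <= z.1 <= x2 -> y1 <= z.2 <= y2 ->
    (x2 - x1) + (y2 - y1) <= d ->
    `|circ P Q x1 x2 y1 y2| <= 2 * e * ((x2 - x1) + (y2 - y1)) ^+ 2.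
Proof.
move=> dP dQ gc e e0; have [d d0 gd] := gc e e0; exists d => // x1 x2 y1 y2 ax ay.
move=> /andP[zx1 zx2] /andP[zy1 zy2] wd.
set w := (x2 - x1) + (y2 - y1) in wd *.
have x12 : x1 <= x2 by exact: le_trans zx2.
have y12 : y1 <= y2 by exact: le_trans zy2.
have loc x y : x1 <= x <= x2 -> y1 <= y <= y2 ->
    `|(g (x, y)).1 - ((g z).1 + c.1 * (x - z.1) - c.2 * (y - z.2))| <= e * w /\
    `|(g (x, y)).2 - ((g z).2 + c.2 * (x - z.1) + c.1 * (y - z.2))| <= e * w.
  move=> /andP[xx1 xx2] /andP[yy1 yy2].
  have hw : l1 (x - z.1, y - z.2) <= w.
    by rewrite /l1 /w lerD//= ler_norml; apply/andP; split; lra.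
  have := gd _ (le_trans hw wd).
  have -> : z + (x - z.1, y - z.2) = (x, y).
    by apply/pair_equal_spec; split; rewrite /= addrC subrK.
  move=> h; have {}h := le_trans h (ler_wpM2l (ltW e0) hw).
  split; apply: le_trans h.
    by rewrite /l1 /= -[leLHS]addr0 lerD// le_eqVlt; apply/orP; left; apply/eqP; congr `|_|; ring.
  by rewrite /l1 /= -[leLHS]add0r lerD// le_eqVlt; apply/orP; left; apply/eqP; congr `|_|; ring.
have horiz y : y1 <= y <= y2 -> `|P y x2 - P y x1 -
    (((g z).2 - c.2 * z.1 + c.1 * (y - z.2)) * (x2 - x1) +
      c.2 * (x2 ^+ 2 - x1 ^+ 2) / 2)| <= e * w * (x2 - x1).
  move=> yy; apply: (@increment_le _ _ (fun x => (g (x, y)).2)) => // x xx.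
    by apply: dP; case/andP: xx => xx _; exact: lt_le_trans xx.
  have [_] := loc x y xx yy; apply: le_trans.
  by rewrite le_eqVlt; apply/orP; left; apply/eqP; congr `|_|; ring.
have vert x : x1 <= x <= x2 -> `|Q x y2 - Q x y1 -
    (((g z).1 + c.2 * z.2 + c.1 * (x - z.1)) * (y2 - y1) +
      (- c.2) * (y2 ^+ 2 - y1 ^+ 2) / 2)| <= e * w * (y2 - y1).
  move=> xx; apply: (@increment_le _ _ (fun y => (g (x, y)).1)) => // y yy.
    by apply: dQ; case/andP: yy => yy _; exact: lt_le_trans yy.
  have [+ _] := loc x y xx yy; apply: le_trans.
  by rewrite le_eqVlt; apply/orP; left; apply/eqP; congr `|_|; ring.
have := horiz y1; rewrite lexx y12 => /(_ isT); set b1 := (X in `|X| <= _) => B1.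
have := horiz y2; rewrite lexx y12 => /(_ isT); set b2 := (X in `|X| <= _) => B2.
have := vert x1; rewrite lexx x12 => /(_ isT); set b3 := (X in `|X| <= _) => B3.
have := vert x2; rewrite lexx x12 => /(_ isT); set b4 := (X in `|X| <= _) => B4.
have -> : circ P Q x1 x2 y1 y2 = b1 + b4 - b2 - b3.
  by rewrite /circ /b1 /b2 /b3 /b4; field.
have n1 := ler_normB (b1 + b4 - b2) b3.
have n2 := ler_normB (b1 + b4) b2.
have n3 := ler_normD b1 b4.
have -> : 2 * e * w ^+ 2 = 2 * (e * w * (x2 - x1)) + 2 * (e * w * (y2 - y1)).
  by rewrite /w; ring.
lra.
Qed.

(** Bisection: one of four quarters keeps at least a quarter of the integral, while near the common
    point of the nested rectangles [circ_small] makes the integral small against the square of their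
    size. *)
Lemma goursat (R : realType) (g : R * R -> R * R) (a : R) (P Q : R -> R -> R)
    (x1 x2 y1 y2 : R) :
  holomorphic g ->
  (forall y x, a < x -> is_derive x 1 (P y) (g (x, y)).2) ->
  (forall x y, a < y -> is_derive y 1 (Q x) (g (x, y)).1) ->
  a < x1 -> a < y1 -> x1 <= x2 -> y1 <= y2 -> circ P Q x1 x2 y1 y2 = 0.
Proof.
move=> hg dP dQ ax ay x12 y12.
pose t n : R := 2^-1 ^+ n.
have tS n : t n = t n.+1 + t n.+1 by rewrite /t exprS; field.
have t0 n : 0 <= t n by rewrite exprn_ge0.
pose W := x2 - x1; pose V := y2 - y1.
have W0 : 0 <= W by rewrite subr_ge0.
have V0 : 0 <= V by rewrite subr_ge0.
pose D n (p : R * R) := circ P Q p.1 (p.1 + W * t n) p.2 (p.2 + V * t n).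
have step n p : exists p' : R * R, [/\ p.1 <= p'.1, p'.1 + W * t n.+1 <= p.1 + W * t n,
    p.2 <= p'.2, p'.2 + V * t n.+1 <= p.2 + V * t n & `|D n p| <= 4 * `|D n.+1 p'|].
  have Wt : 0 <= W * t n.+1 by rewrite mulr_ge0.
  have Vt : 0 <= V * t n.+1 by rewrite mulr_ge0.
  have Wn : W * t n = W * t n.+1 + W * t n.+1 by rewrite tS mulrDr.
  have Vn : V * t n = V * t n.+1 + V * t n.+1 by rewrite tS mulrDr.
  have DE : D n p = D n.+1 p + D n.+1 (p.1 + W * t n.+1, p.2) +
      D n.+1 (p.1, p.2 + V * t n.+1) + D n.+1 (p.1 + W * t n.+1, p.2 + V * t n.+1).
    by rewrite /D /= (circ_split _ _ _ (p.1 + W * t n.+1) _ _ (p.2 + V * t n.+1))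
      Wn Vn !addrA.
  set p1 := p in DE; set p2 := (_ + _, _) in DE; set p3 := (_, _ + _) in DE.
  set p4 := (_, _) in DE.
  have [h1|h1] := leP `|D n p| (4 * `|D n.+1 p1|); first by exists p1; split=> //; lra.
  have [h2|h2] := leP `|D n p| (4 * `|D n.+1 p2|).
    by exists p2; rewrite /p2; split=> //=; lra.
  have [h3|h3] := leP `|D n p| (4 * `|D n.+1 p3|).
    by exists p3; rewrite /p3; split=> //=; lra.
  have [h4|h4] := leP `|D n p| (4 * `|D n.+1 p4|).
    by exists p4; rewrite /p4; split=> //=; lra.
  exfalso.
  have n1 := ler_normD (D n.+1 p1 + D n.+1 p2 + D n.+1 p3) (D n.+1 p4).
  have n2 := ler_normD (D n.+1 p1 + D n.+1 p2) (D n.+1 p3).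
  have n3 := ler_normD (D n.+1 p1) (D n.+1 p2).
  rewrite -DE in n1; lra.
have [next nextP] := choice (fun np : nat * (R * R) => step np.1 np.2).
pose q := fix q n := if n is n'.+1 then next (n', q n') else (x1, y1).
have qP n := nextP (n, q n).
pose C n := `[(q n).1, (q n).1 + W * t n] `*` `[(q n).2, (q n).2 + V * t n].
have Cdec n : C n.+1 `<=` C n.
  have [h1 h2 h3 h4 _] := qP n => -[x y] []; rewrite /= !in_itv /= => /andP[? ?] /andP[? ?].
  split; rewrite /= in_itv /=; apply/andP; split; apply: le_trans; eassumption.
have cC n : compact (C n) by apply: compact_setX; exact: segment_compact.
have clC n : closed (C n).
  by apply: compact_closed => //; exact: norm_hausdorff.
have C0 n : C n !=set0.
  by exists (q n); split; rewrite /= in_itv /= lexx lerDl mulr_ge0.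
have CC0 n : C n `<=` C 0%N by elim: n => // n; exact: subset_trans.
have [z zC] := closed_nested_compact (cC 0%N) clC CC0 C0 Cdec.
have qge n : x1 <= (q n).1 /\ y1 <= (q n).2.
  elim: n => // n [h1 h2]; have [h3 _ h4 _ _] := qP n.
  by split; [exact: le_trans h3|exact: le_trans h4].
have Dq n : `|D 0%N (q 0%N)| <= 4 ^+ n * `|D n (q n)|.
  elim: n => [|n IH]; first by rewrite mul1r.
  rewrite (le_trans IH)// exprSr -mulrA ler_wpM2l ?exprn_ge0//.
  by have [] := qP n.
have -> : circ P Q x1 x2 y1 y2 = D 0%N (q 0%N).
  by rewrite /D /= /t expr0 !mulr1 /W /V ![_ + (_ - _)]addrC !subrK.
apply/eqP; rewrite -normr_le0; apply/ler_addgt0Pr => e e0; rewrite add0r.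
have S0 : 0 < 2 * ((W + V) ^+ 2 + 1) by rewrite mulr_gt0// ltr_wpDl// sqr_ge0.
have [c gc] := hg z.
(* The summand 1 in the divisor keeps it positive for a degenerate rectangle; the factors [4 ^+ n]
   and [t n ^+ 2] will cancel. *)
have [d d0 small] := circ_small dP dQ gc (divr_gt0 e0 S0).
have [n nd] : exists n, (W + V) * t n <= d.
  exists (Num.bound ((W + V) / d)).
  rewrite /t exprVn ler_pdivrMr ?exprn_gt0// mulrC -ler_pdivrMr//.
  have h := archi_boundP (divr_ge0 (addr_ge0 W0 V0) (ltW d0)).
  by rewrite (le_trans (ltW h))// -natrX ler_nat ltnW// ltn_expl.
have [zx zy] := zC n I; rewrite /= !in_itv /= in zx zy.
have [qx qy] := qge n.
have wE : (q n).1 + W * t n - (q n).1 + ((q n).2 + V * t n - (q n).2) = (W + V) * t n.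
  by ring.
have := small _ _ _ _ (lt_le_trans ax qx) (lt_le_trans ay qy) zx zy.
rewrite wE => /(_ nd) h.
rewrite (le_trans (Dq n))//.
rewrite (le_trans (ler_wpM2l (exprn_ge0 n (ler0n _ 4)) h))//.
have t4 : 4 ^+ n * t n ^+ 2 = 1 :> R.
  rewrite /t -exprM mulnC exprM exprVn -exprVn -exprMn.
  by rewrite (_ : 4 * _ = 1) ?expr1n//; field.
rewrite [leLHS](_ : _ = 4 ^+ n * t n ^+ 2 * (e * ((W + V) ^+ 2 / ((W + V) ^+ 2 + 1)))).
  rewrite t4 mul1r ger_pMr// ler_pdivrMr ?mul1r ?lerDl//.
  by rewrite ltr_wpDl// sqr_ge0.
field.
by rewrite gt_eqF// ltr_wpDl// sqr_ge0.
Qed.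

(** For [g] pulled back by the exponential, the horizontal sides of the rectangle [s, ln r] x
    [0, 2 pi] cancel by periodicity. So the circles of radius [r] and [expR s] have the same mean,
    and on the small one [g] is close to its value at [z]. *)
Lemma mean_value (R : realType) (g : R * R -> R * R) (z : R * R) (r : R)
    (q : R -> R) :
  holomorphic g -> 0 < r ->
  (forall t, 0 <= t <= pi *+ 2 ->
    is_derive t 1 q (g (z.1 + r * cos t, z.2 + r * sin t)).1) ->
  q (pi *+ 2) - q 0 = pi *+ 2 * (g z).1.
Proof.
move=> hg r0 dq.
have pi2 : 0 < pi *+ 2 :> R by rewrite mulrn_wgt0// pi_gt0.
pose H w := g (z + polar w).
have hH : holomorphic H.
  move=> w; have [c gc] := hg (z + polar w).
  exists (cmul c (polar w)).
  apply: (cderiv_comp (g := fun w => z + polar w)) gc => e e0.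
  have [d d0 pd] := polar_cderiv w e0; exists d => // h /pd; apply: le_trans.
  by rewrite opprD addrACA subrr add0r.
have cH := holomorphic_continuous hH.
have cH1 x : continuous (fun y => (H (x, y)).1).
  move=> y; apply: (for_continuous_fst (f := fun y => H (x, y))); apply: (for_continuous_comp (g := H)); last exact: cH.
  by apply: for_continuous_pair; [exact: cvg_cst|exact: for_continuous_id].
have cH2 y : continuous (fun x => (H (x, y)).2).
  move=> x; apply: (for_continuous_snd (f := fun x => H (x, y))); apply: (for_continuous_comp (g := H)); last exact: cH.
  by apply: for_continuous_pair; [exact: for_continuous_id|exact: cvg_cst].
apply/eqP; rewrite -subr_eq0 -normr_le0; apply/ler_addgt0Pr => e e0; rewrite add0r.
have e1 : 0 < e / (pi *+ 2) by rewrite divr_gt0.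
have /cvgrPdist_le/(_ _ e1)/nbhs_ballP[d /= d0 gd] :
    {for z, continuous (fun w => (g w).1)}.
  by apply: (for_continuous_fst (f := g)); exact: holomorphic_continuous.
have [s [sr sd]] : exists s, s <= ln r /\ expR s < d.
  exists (Num.min (ln r) (ln (d / 2))); rewrite ge_min lexx; split=> //.
  apply: (@le_lt_trans _ _ (d / 2)); last by rewrite ltr_pdivrMr// mulr_natr mulr2n ltrDl.
  by rewrite -[leRHS]lnK ?posrE ?divr_gt0// ler_expR ge_min lexx orbT.
have [a [as_ a0]] : exists a, a < s /\ a < 0.
  by have [h|h] := leP s 0; [exists (s - 1)|exists (-1)]; split; lra.
(* Primitives are chosen as a function of the integrand alone, so the equal integrands at heights 0
   and [pi *+ 2] receive the same primitive. *)
have [prim primP] : exists prim : (R -> R) -> R -> R, forall h, continuous h ->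
    forall x, a < x -> is_derive x 1 (prim h) (h x).
  have pex (h : R -> R) : exists F : R -> R, continuous h ->
      forall x, a < x -> is_derive x 1 F (h x).
    have [ch|nch] := pselect (continuous h); last by exists id.
    by have [F dF] := antiderivative a ch; exists F.
  by have [prim primP] := choice pex; exists prim.
pose P y := prim (fun x => (H (x, y)).2).
pose Q x := prim (fun y => (H (x, y)).1).
have := @goursat _ H a P Q s (ln r) 0 (pi *+ 2) hH _ _ as_ a0 sr (ltW pi2).
rewrite /circ.
have -> : P (pi *+ 2) = P 0.
  by rewrite /P; congr (prim _); apply/funext => x; rewrite /H /polar /= cos2pi sin2pi cos0 sin0.
move=> G.
have {}G : Q (ln r) (pi *+ 2) - Q (ln r) 0 = Q s (pi *+ 2) - Q s 0.
  have h : forall u v w : R, u + v - u - w = 0 -> v = w by move=> u v w; lra.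
  apply: h; apply: G => [y x|x y] ax.
    exact: (primP (fun x => (H (x, y)).2)).
  exact: (primP (fun y => (H (x, y)).1)).
have qQ : q (pi *+ 2) - q 0 = Q (ln r) (pi *+ 2) - Q (ln r) 0.
  apply/eqP; rewrite -subr_eq0 -normr_le0.
  have := @increment_le _ (fun t => q t - Q (ln r) t) (fun=> 0) 0 (pi *+ 2) 0 0 0 (ltW pi2).
  have -> : q (pi *+ 2) - q 0 - (Q (ln r) (pi *+ 2) - Q (ln r) 0) =
      q (pi *+ 2) - Q (ln r) (pi *+ 2) - (q 0 - Q (ln r) 0) by ring.
  rewrite !mul0r !addr0 subr0.
  apply => t tt; last by rewrite mul0r addr0 subr0 normr0.
  have t0 : a < t by case/andP: tt => tt _; exact: lt_le_trans tt.
  apply: is_derive_eq (is_deriveB (dq t tt) (primP (fun y => (H (ln r, y)).1) (cH1 _) t t0)) _.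
  by rewrite /H /polar /= lnK ?posrE// subrr.
rewrite qQ G.
have := @increment_le _ (Q s) (fun t => (H (s, t)).1) 0 (pi *+ 2) (g z).1 0 (e / (pi *+ 2)) (ltW pi2).
rewrite !mul0r !addr0 subr0 divfK ?gt_eqF// [(g z).1 * _]mulrC; apply => t tt.
  apply: (primP (fun y => (H (s, y)).1)) => //.
  by case/andP: tt => tt _; exact: lt_le_trans tt.
rewrite mul0r addr0 distrC; apply: gd.
split; rewrite /ball /= opprD addrA subrr sub0r normrN normrM ger0_norm ?expR_ge0//.
  by rewrite (le_lt_trans _ sd)// ler_piMr ?expR_ge0// ler_norml cos_geN1 cos_le1.
by rewrite (le_lt_trans _ sd)// ler_piMr ?expR_ge0// ler_norml sin_geN1 sin_le1.
Qed.

(** Averaging over the circle kills the [cos] and [sin] terms, so the mean would fall short of the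
    central value by [e]. The term in [l] absorbs the linear part of the quadratic perturbation in
    [maximum_principle]. *)
Lemma no_superharmonic_point (R : realType) (g : R * R -> R * R) (z l : R * R)
    (r e : R) :
  holomorphic g -> 0 < r -> 0 < e ->
  ~ (forall t, (g (z.1 + r * cos t, z.2 + r * sin t)).1 <=
       (g z).1 + (l.1 * cos t + l.2 * sin t) - e).
Proof.
move=> hg r0 e0 gle.
have pi2 : 0 < pi *+ 2 :> R by rewrite mulrn_wgt0// pi_gt0.
have cg : continuous (fun t => (g (z.1 + r * cos t, z.2 + r * sin t)).1).
  move=> t; apply: (for_continuous_fst (f := fun t => g (z.1 + r * cos t, z.2 + r * sin t))).
  apply: (for_continuous_comp (g := g)); last exact: holomorphic_continuous.
  apply: for_continuous_pair; (apply: cvgD; first exact: cvg_cst);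
    (apply: cvgM; first exact: cvg_cst).
    exact: continuous_cos.
  exact: continuous_sin.
have [q dq] := antiderivative (-1) cg.
have dq' t : 0 <= t <= pi *+ 2 ->
    is_derive t 1 q (g (z.1 + r * cos t, z.2 + r * sin t)).1.
  by move=> /andP[t0 _]; apply: dq; rewrite (lt_le_trans _ t0).
have mv := mean_value hg r0 dq'.
pose F t := q t - ((g z).1 - e) * t - (l.1 * sin t - l.2 * cos t).
have dF t : 0 <= t <= pi *+ 2 -> is_derive t 1 F
    ((g (z.1 + r * cos t, z.2 + r * sin t)).1 - ((g z).1 - e)
      - (l.1 * cos t + l.2 * sin t)).
  move=> /dq' dqt.
  have d1 := is_deriveZ ((g z).1 - e) (is_derive_id t 1).
  have d2 := is_deriveB (is_deriveZ l.1 (is_derive_sin t)) (is_deriveZ l.2 (is_derive_cos t)).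
  by apply: is_derive_eq (is_deriveB (is_deriveB dqt d1) d2) _; rewrite /GRing.scale /=; ring.
have [c cc] : exists2 c, c \in `[0, pi *+ 2] & F (pi *+ 2) - F 0 =
    ((g (z.1 + r * cos c, z.2 + r * sin c)).1 - ((g z).1 - e)
      - (l.1 * cos c + l.2 * sin c)) * (pi *+ 2 - 0).
  apply: (MVT_segment (ltW pi2)) => [t|].
    by rewrite in_itv /= => /andP[h1 h2]; apply: dF; rewrite !ltW.
  apply: derivable_within_continuous => t.
  by rewrite in_itv /= => tt; have [] := dF t tt.
have -> : F (pi *+ 2) - F 0 = e * (pi *+ 2).
  have -> : F (pi *+ 2) - F 0 = (q (pi *+ 2) - q 0) - ((g z).1 - e) * (pi *+ 2).
    by rewrite /F cos2pi sin2pi cos0 sin0; ring.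
  by rewrite mv; ring.
rewrite subr0 => /mulIf; rewrite gt_eqF// => /(_ isT) h.
have := gle c; lra.
Qed.

(** * The Euclidean norm and the maximum principle *)

Definition enorm (R : realType) (z : R * R) : R := Num.sqrt (dot z z).

Lemma dot_ge0 (R : realType) (z : R * R) : 0 <= dot z z.
Proof. by rewrite addr_ge0// -expr2 sqr_ge0. Qed.

Lemma dot_continuous (R : realType) : continuous (fun z : R * R => dot z z).
Proof. by move=> z; apply: dot_cvg; exact: for_continuous_id. Qed.

Lemma enorm_continuous (R : realType) : continuous (@enorm R).
Proof.
move=> z; apply: (for_continuous_comp (g := Num.sqrt) (f := fun z => dot z z)).
  exact: dot_continuous.
exact: sqrt_continuous.
Qed.

Lemma enorm_le_compact (R : realType) (B : R) : compact [set z : R * R | enorm z <= B].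
Proof.
apply: (@subclosed_compact _ _ (`[-B, B] `*` `[-B, B])).
- by apply: closed_sublevel; exact: enorm_continuous.
- by apply: compact_setX; exact: segment_compact.
have loc (x y : R) : Num.sqrt (x ^+ 2 + y ^+ 2) <= B -> -B <= x <= B.
  move=> h; rewrite -ler_norml -sqrtr_sqr (le_trans _ h)//.
  by rewrite ler_sqrt ?lerDl ?sqr_ge0// addr_ge0 ?sqr_ge0.
move=> [x y]; rewrite /enorm /dot /= -!expr2 => h.
by split; rewrite /= in_itv /=; [exact: loc h|apply: (loc _ x); rewrite addrC].
Qed.

Lemma cauchy_schwarz (R : realType) (w z : R * R) : dot w z <= enorm w * enorm z.
Proof.
rewrite /enorm -sqrtrM ?dot_ge0//.
have [h|h] := leP (dot w z) 0; first by rewrite (le_trans h)// sqrtr_ge0.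
rewrite -(ger0_norm (ltW h)) -sqrtr_sqr ler_sqrt ?mulr_ge0 ?dot_ge0//.
rewrite -subr_ge0 (_ : _ - _ = (cross w z) ^+ 2) ?sqr_ge0//.
by rewrite /dot /cross; ring.
Qed.

(** Multiplying by the conjugate of [w = g z0] turns the modulus at [z0] into a real part. A small
    multiple of the squared distance to [z0] makes this real part strictly subharmonic, which
    forbids an interior maximum. *)
Lemma maximum_principle (R : realType) (g : R * R -> R * R) (G : set (R * R))
    (B M : R) :
  holomorphic g -> 0 <= M -> open G -> G `<=` [set z | enorm z <= B] ->
  (forall z, closure G z -> ~ G z -> enorm (g z) <= M) ->
  forall z, G z -> enorm (g z) <= M.
Proof.
move=> hg M0 oG GB GM z0 Gz0; rewrite leNgt; apply/negP => gz0.
have cg := holomorphic_continuous hg.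
set w := g z0 in gz0 *.
pose k z := cmul (w.1, - w.2) (g z).
have kE z : (k z).1 = dot w (g z) by rewrite /k /cmul /dot /=; ring.
have hk : holomorphic k.
  move=> z; have [c gc] := hg z; exists (cmul (w.1, - w.2) c).
  apply: (cderiv_comp (k := cmul (w.1, - w.2)) gc) => e e0.
  exists 1 => // h _.
  rewrite (_ : _ - _ - _ = 0).
    by rewrite {1}/l1 normr0 addr0 mulr_ge0 ?l1_ge0// ltW.
  by apply/pair_equal_spec; split; rewrite /=; ring.
have cK : compact (closure G).
  apply: (subclosed_compact _ (@enorm_le_compact _ B)); first exact: closed_closure.
  rewrite (closure_id [set z | enorm z <= B]).1; first exact: closureS.
  by apply: closed_sublevel; exact: enorm_continuous.
have K0 : closure G !=set0 by exists z0; exact: subset_closure.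
pose D z := dot (z - z0) (z - z0).
have cD : continuous D.
  move=> z; apply: (dot_cvg (f := fun z : R * R => z - z0) (g := fun z => z - z0));
    by apply: cvgB; [exact: cvg_id|exact: cvg_cst].
have ck : continuous (fun z => (k z).1).
  by move=> z; apply: (for_continuous_fst (f := k)); exact: holomorphic_continuous.
have [b _ bD] := compact_EVT_max K0 cK (continuous_subspaceT cD).
have w0 : 0 < enorm w by exact: le_lt_trans gz0.
have ww : enorm w * enorm w = dot w w by rewrite -expr2 sqr_sqrtr// dot_ge0.
have Db0 : 0 < 2 * (D b + 1) by rewrite mulr_gt0// ltr_wpDl// dot_ge0.
have gap : 0 < enorm w * (enorm w - M) by rewrite mulr_gt0// subr_gt0.
(* So small that [e * D] uses at most half of the gap: a boundary point cannot reach the value at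
   [z0]. *)
pose e := enorm w * (enorm w - M) / (2 * (D b + 1)).
have e0 : 0 < e by rewrite divr_gt0.
have eD z : closure G z -> e * D z <= enorm w * (enorm w - M) / 2.
  move=> Kz; have h : D z <= D b by apply: bD; rewrite inE.
  rewrite (le_trans (ler_wpM2l (ltW e0) h))//.
  have : e * (2 * (D b + 1)) = enorm w * (enorm w - M) by rewrite divfK// gt_eqF.
  have -> : e * (2 * (D b + 1)) = 2 * (e * D b) + 2 * e by ring.
  lra.
have cv : continuous (fun z => (k z).1 + e * D z).
  move=> z; apply: cvgD; first exact: ck.
  by apply: cvgM; [exact: cvg_cst|exact: cD].
have [z1] := compact_EVT_max K0 cK (continuous_subspaceT cv).
rewrite inE => Kz1 vmax.
have vz0 : dot w w <= (k z1).1 + e * D z1.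
  have := vmax z0; rewrite inE => /(_ (subset_closure Gz0)).
  by rewrite kE -/w /D subrr /dot /= !mul0r !addr0 mulr0 addr0.
have Gz1 : G z1.
  apply: contrapT => nG.
  have h1 := GM _ Kz1 nG.
  have h2 := cauchy_schwarz w (g z1).
  have h3 := ler_wpM2l (ltW w0) h1.
  have h4 := eD _ Kz1.
  move: vz0; rewrite kE -ww => vz0.
  have : enorm w * (enorm w - M) = enorm w * enorm w - enorm w * M by ring.
  lra.
have [r r0 rG] : exists2 r : R, 0 < r &
    forall t, G (z1.1 + r * cos t, z1.2 + r * sin t).
  have /nbhs_ballP[d /= d0 dG] : nbhs z1 G by exact: open_nbhs_nbhs.
  exists (d / 2); first by rewrite divr_gt0.
  have d2 : d / 2 < d by rewrite ltr_pdivrMr// mulr_natr mulr2n ltrDl.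
  have d2' : 0 <= d / 2 by rewrite divr_ge0// ltW.
  move=> t; apply: dG; split; rewrite /ball /= opprD addrA subrr sub0r normrN;
    rewrite normrM (ger0_norm d2') (le_lt_trans _ d2)// ler_piMr//.
    by rewrite ler_norml cos_geN1 cos_le1.
  by rewrite ler_norml sin_geN1 sin_le1.
(* On the circle around [z1], [e * D] exceeds its central value by [e * r ^+ 2] plus a part linear
   in [cos t] and [sin t]; maximality at [z1] transfers both to [k] with the opposite sign. *)
apply: (@no_superharmonic_point _ k z1
  (- (2 * e * r) * (z1.1 - z0.1), - (2 * e * r) * (z1.2 - z0.2)) r (e * r ^+ 2)) => //.
  by rewrite mulr_gt0// exprn_gt0.
move=> t; have := vmax (z1.1 + r * cos t, z1.2 + r * sin t).
rewrite inE => /(_ (subset_closure (rG t))).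
have -> : D (z1.1 + r * cos t, z1.2 + r * sin t) = D z1 +
    2 * r * (cos t * (z1.1 - z0.1) + sin t * (z1.2 - z0.2)) + r ^+ 2.
  have -> : r ^+ 2 = r ^+ 2 * (cos t ^+ 2 + sin t ^+ 2) by rewrite cos2Dsin2 mulr1.
  by rewrite /D /dot /=; ring.
move=> h.
rewrite -subr_ge0 in h; rewrite -subr_ge0.
by apply: le_trans h _; rewrite le_eqVlt; apply/orP; left; apply/eqP; rewrite /=; ring.
Qed.

(** * Continuous arguments and separation of the plane *)

(** The argument lives on an open neighbourhood of [K], so it is continuous in the plane and
    available on nearby parts of other sets. *)
Definition has_angle (R : realType) (K : set (R * R)) (a : R * R) : Prop :=
  exists O (alpha : R * R -> R), [/\ open O, K `<=` O,
    forall z, O z -> {for z, continuous alpha} &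
    forall z, O z -> is_angle (z - a) (alpha z)].

Lemma subr_for_continuous (R : realType) (a z : R * R) :
  {for z, continuous (fun z : R * R => z - a)}.
Proof. by apply: cvgB; [exact: cvg_id|exact: cvg_cst]. Qed.

Lemma dang_subr_for_continuous (R : realType) (a a' z : R * R) :
  dot (z - a) (z - a') != 0 ->
  {for z, continuous (fun z : R * R => dang (z - a) (z - a'))}.
Proof. by move=> d0; apply: dang_cvg => //; exact: subr_for_continuous. Qed.

Lemma open_dot_gt0 (R : realType) (f g : R * R -> R * R) :
  continuous f -> continuous g -> open [set z | 0 < dot (f z) (g z)].
Proof.
move=> cf cg.
rewrite (_ : [set _ | _] = (fun z => dot (f z) (g z)) @^-1` [set x | 0 < x])//.
apply: open_comp; last exact: open_gt.
by move=> z _; apply: dot_cvg; [exact: cf|exact: cg].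
Qed.

(** The viewpoint moves from [a] to [a'] by adding the signed angle between the two directions,
    which is acute on [K]. *)
Lemma has_angle_step (R : realType) (K : set (R * R)) (a a' : R * R) :
  has_angle K a -> (forall z, K z -> 0 < dot (z - a) (z - a')) -> has_angle K a'.
Proof.
move=> [D [al [oD KD cal alP]]] d0.
exists (D `&` [set z | 0 < dot (z - a) (z - a')]).
exists (fun z => al z + dang (z - a) (z - a')); split.
- by apply: openI => //; apply: open_dot_gt0 => z; exact: subr_for_continuous.
- by move=> z Kz; split; [exact: KD|exact: d0].
- move=> z [Dz dz]; apply: cvgD; first exact: cal.
  by apply: dang_subr_for_continuous; rewrite gt_eqF.
- by move=> z [Dz dz]; apply: is_angle_dang => //; exact: alP.
Qed.

Lemma dotC (R : realType) (w z : R * R) : dot w z = dot z w.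
Proof. by rewrite /dot; ring. Qed.

Lemma near_dot_gt0 (R : realType) (K : set (R * R)) (a : R * R) :
  compact K -> ~ K a ->
  \forall a' \near a, forall z, K z -> 0 < dot (z - a) (z - a').
Proof.
move=> cK nKa.
move/compact_near_coveringP : cK => /(_ _ (nbhs a) (fun a' z =>
  0 < dot (z - a) (z - a'))) /=; apply.
move=> z Kz.
have za : z - a != 0 by rewrite subr_eq0; apply: contra_notN nKa => /eqP <-.
have : {for (z, a), continuous (fun q : (R * R) * (R * R) =>
    dot (q.1 - a) (q.1 - q.2))}.
  have c1 := for_continuous_fst (@for_continuous_id _ (z, a)).
  have c2 := for_continuous_snd (@for_continuous_id _ (z, a)).
  apply: (dot_cvg (f := fun q : (R * R) * (R * R) => q.1 - a)
    (g := fun q : (R * R) * (R * R) => q.1 - q.2)).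
    by apply: cvgB => //; exact: cvg_cst.
  exact: cvgB.
move=> h; exact: cvgr_gt h _ (dot_gt0 za).
Qed.

Lemma orbits_le_compact (R : realType) (f : R * R -> R * R) (M : R) :
  continuous f -> compact (orbits_le (@enorm R) f M).
Proof.
move=> cf; apply: subclosed_compact (@enorm_le_compact _ M) _.
  by apply: closed_orbits_le => //; exact: enorm_continuous.
by move=> z /(_ 0%N).
Qed.

Lemma enormN (R : realType) (z : R * R) : enorm (- z) = enorm z.
Proof. by rewrite /enorm /dot /= !mulrNN. Qed.

(** Seen from [a], the set [K] lies in the open half plane of direction [- a], where angles measured
    from [- a] vary continuously. *)
Lemma has_angle_far (R : realType) (K : set (R * R)) (M : R) (a : R * R) :
  0 <= M -> K `<=` [set z | enorm z <= M] -> M < enorm a -> has_angle K a.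
Proof.
move=> M0 KM Ma.
have a0 : - a != 0.
  rewrite oppr_eq0; apply/eqP => a0; move: Ma.
  by rewrite a0 /enorm /dot /= mulr0 addr0 sqrtr0 ltNge M0.
have [t ta] := is_angle_exists a0.
exists [set z | 0 < dot (- a) (z - a)], (fun z => t + dang (- a) (z - a)); split.
- by apply: open_dot_gt0 => z; [exact: cvg_cst|exact: subr_for_continuous].
- move=> z /KM /= zM.
  have -> : dot (- a) (z - a) = dot a a - dot a z by rewrite /dot /=; ring.
  rewrite subr_gt0 (le_lt_trans (cauchy_schwarz _ _))//.
  rewrite -[ltRHS]sqr_sqrtr ?dot_ge0// -/(enorm a) expr2 ltr_pM2l.
    exact: le_lt_trans Ma.
  exact: le_lt_trans Ma.
- move=> z dz; apply: cvgD; first exact: cvg_cst.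
  have h : {for z, continuous (fun z : R * R => dang (- a) (z - a))}.
    apply: dang_cvg; [exact: cvg_cst|exact: subr_for_continuous|].
    by rewrite gt_eqF.
  exact: h.
- by move=> z dz; exact: is_angle_dang.
Qed.

(* The points of the complement of [K] seen from [K] without a continuous angle
   form a bounded open set with boundary in [K]; the maximum principle for the
   iterates puts this set inside [K]. *)
Lemma orbits_le_has_angle (R : realType) (f : R * R -> R * R) (M : R) (a : R * R) :
  holomorphic f -> ~ orbits_le (@enorm R) f M a ->
  has_angle (orbits_le (@enorm R) f M) a.
Proof.
move=> hf; set K := orbits_le _ _ _ => nKa.
have cK : compact K by apply: orbits_le_compact; exact: holomorphic_continuous.
have clK : closed K by apply: compact_closed => //; exact: norm_hausdorff.
have [M0|M0] := leP 0 M; last first.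
  exists set0, (fun=> 0); split=> //.
  by move=> z /(_ 0%N) /= /le_lt_trans /(_ M0); rewrite ltNge sqrtr_ge0.
pose G := [set a | ~ K a /\ ~ has_angle K a].
apply: contrapT => naK.
have oG : open G.
  rewrite openE => b [nKb nb].
  have nb1 := near_dot_gt0 cK nKb.
  have nb2 : nbhs b (~` K) by apply: open_nbhs_nbhs; split=> //; exact: closed_openC.
  apply: filterS2 nb1 nb2 => b' b'1 b'2; split=> // hb'.
  by apply: nb; apply: has_angle_step hb' _ => z Kz; rewrite dotC b'1.
have GM : G `<=` [set z | enorm z <= M].
  move=> b [nKb nb] /=; rewrite leNgt; apply/negP => Mb; apply: nb.
  by apply: has_angle_far M0 _ Mb => z /(_ 0%N).
have Ga : G a by [].
apply: nKa => n.
apply: (maximum_principle (holomorphic_iter n hf) M0 oG GM) Ga => b clb nGb.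
(* A boundary point [b] outside [K] has an argument, since otherwise it would belong to [G]; a
   nearby point of [G] would inherit it. *)
apply: contrapT => bM.
have nKb : ~ K b by move=> /(_ n).
have hb : has_angle K b by apply: contrapT => hb; exact: nGb.
have [b' [[_ nb'] db']] := clb _ (near_dot_gt0 cK nKb).
by apply: nb'; exact: has_angle_step hb _.
Qed.

(** * Comparing the directions from two points *)

Definition unit_of (R : realType) (w : R * R) : R * R :=
  (w.1 / enorm w, w.2 / enorm w).

Lemma enorm_gt0 (R : realType) (w : R * R) : w != 0 -> 0 < enorm w.
Proof. by move=> w0; rewrite sqrtr_gt0 dot_gt0. Qed.

Lemma unit_of_continuous (R : realType) (w : R * R) :
  w != 0 -> {for w, continuous (@unit_of R)}.
Proof.
move=> w0; have nw : enorm w != 0 by rewrite gt_eqF// enorm_gt0.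
have cV : {for w, continuous (fun w : R * R => (enorm w)^-1)}.
  by apply: cvgV => //; exact: enorm_continuous.
apply: for_continuous_pair; apply: cvgM; try exact: cV.
  exact: for_continuous_fst (@for_continuous_id _ w).
exact: for_continuous_snd (@for_continuous_id _ w).
Qed.

Lemma unit_of_is_angle (R : realType) (w : R * R) t :
  is_angle w t -> unit_of w = (cos t, sin t).
Proof.
move=> [r r0 ->].
have e : enorm (r * cos t, r * sin t) = r.
  rewrite /enorm; have -> : dot (r * cos t, r * sin t) (r * cos t, r * sin t) = r ^+ 2.
    by rewrite -[RHS]mulr1 -(cos2Dsin2 t) /dot /=; ring.
  by rewrite sqrtr_sqr gtr0_norm.
by rewrite /unit_of e /= ![r * _]mulrC !mulfK// gt_eqF.
Qed.

Lemma cos_sin_neq0 (R : realType) (t : R) : (cos t, sin t) != 0 :> R * R.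
Proof.
apply/eqP => -[c0 s0]; have := cos2Dsin2 t.
by rewrite c0 s0 expr0n addr0 => /esym/eqP; rewrite oner_eq0.
Qed.

(** An argument of (z - b) / (z - a), expressed through arguments of numerator and denominator. *)
Definition view_angle (R : realType) (a b z : R * R) (t : R) : Prop :=
  exists2 c, is_angle (z - a) c & is_angle (z - b) (c + t).

Lemma view_angle_unit_of (R : realType) (a b z : R * R) t :
  view_angle a b z t -> unit_of (z - b) = cmul (cos t, sin t) (unit_of (z - a)).
Proof.
move=> [c ac bc]; rewrite (unit_of_is_angle ac) (unit_of_is_angle bc).
by rewrite cosD sinD /cmul; apply/pair_equal_spec; split; rewrite /=; ring.
Qed.

Lemma view_angle_dang (R : realType) (a b z : R * R) :
  0 < dot (z - a) (z - b) -> view_angle a b z (dang (z - a) (z - b)).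
Proof.
move=> d0; have [|c ac] := @is_angle_exists _ (z - a).
  by apply: contraTneq d0 => ->; rewrite /dot /= !mul0r addr0 ltxx.
by exists c => //; exact: is_angle_dang.
Qed.

(** By Cauchy-Schwarz the product is at least |z|^2 - (|a| + |b|) |z| - |a| |b|. This supplies the
    view angle near infinity. *)
Lemma enormD_dot (R : realType) (a b z : R * R) :
  2 * (enorm a + enorm b) + 1 <= enorm z -> 0 < dot (z - a) (z - b).
Proof.
move=> h.
have -> : dot (z - a) (z - b) = dot z z - dot a z - dot b z - dot (- a) b.
  by rewrite /dot /=; ring.
have h1 := cauchy_schwarz a z; have h2 := cauchy_schwarz b z.
have := cauchy_schwarz (- a) b; rewrite enormN => h3.
have -> : dot z z = enorm z * enorm z by rewrite -expr2 sqr_sqrtr ?dot_ge0.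
move: h h1 h2 h3; have := sqrtr_ge0 (dot a a); have := sqrtr_ge0 (dot b b).
rewrite -!/(enorm _); move: (enorm a) (enorm b) (enorm z) => A B Z B0 A0 h h1 h2 h3.
have : (2 * (A + B) + 1) * Z <= Z * Z by rewrite ler_wpM2r//; lra.
have : A * B <= A * Z by rewrite ler_wpM2l//; lra.
have : 0 <= B * Z by rewrite mulr_ge0//; lra.
have -> : (2 * (A + B) + 1) * Z = 2 * (A * Z) + 2 * (B * Z) + Z by ring.
have : 0 <= A * Z by rewrite mulr_ge0//; lra.
lra.
Qed.

Lemma compact_directed_cover (T : topologicalType) (A : set T) (good : set (set T)) :
  compact A -> good set0 ->
  (forall W1 W2, good W1 -> good W2 -> good (W1 `|` W2)) ->
  (forall x, A x -> exists W, [/\ good W, open W & W x]) ->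
  exists2 W, good W & A `<=` W.
Proof.
move=> cA g0 gU gA; apply: contrapT => /forall2NP noW.
pose F := filter_from good (fun W => A `\` W).
have FF : ProperFilter F.
  apply: filter_from_proper.
    apply: filter_from_filter; first by exists set0.
    move=> W1 W2 g1 g2; exists (W1 `|` W2); first exact: gU.
    by move=> x [Ax /not_orP[n1 n2]]; split; split.
  by move=> W gW; have [//|/existsNP[x /not_implyP[]]] := noW W; exists x.
have FA : F A by exists set0 => // x [].
have [x [Ax Fx]] := cA F FF FA.
have [W [gW oW Wx]] := gA x Ax.
have FW : F (A `\` W) by exists W.
have [y [[_ nWy] Wy]] := Fx _ _ FW (open_nbhs_nbhs (conj oW Wx)).
exact: nWy.
Qed.

Lemma within_continuous_glue (T : topologicalType) (S : topologicalType)
    (A B C : set T) (f g : T -> S) :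
  closed A -> closed B -> A `<=` C -> B `<=` ~` C ->
  {within A, continuous f} -> {within B, continuous g} ->
  {within A `|` B, continuous (fun z => if z \in C then f z else g z)}.
Proof.
move=> clA clB AC BC cf cg; apply: withinU_continuous => //.
  apply: subspace_eq_continuous cf => z zA.
  by rewrite /from_subspace mem_set//; apply: AC; rewrite inE in zA.
apply: subspace_eq_continuous cg => z zB.
by rewrite /from_subspace memNset//; apply: BC; rewrite inE in zB.
Qed.

(* If a closed set [F] carries a continuous angle from [z - a] to [z - b], also
   defined near infinity, then [F] does not separate [a] from [b]: otherwise the
   angle turns the direction field of [z - a] on the side of [b] into an
   extension of the direction field of [z - b], without zeros in the plane. *)
Lemma view_angle_not_separated (R : realType) (A U V : set (R * R))
    (a b : R * R) (alpha : R * R -> R) (M B : R) :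
  open U -> open V -> U `&` V = set0 -> U a -> V b -> closed A ->
  ~` (U `|` V) `<=` A -> [set z | B <= enorm z] `<=` A ->
  {within A, continuous alpha} -> (forall z, A z -> `|alpha z| <= M) ->
  (forall z, A z -> view_angle a b z (alpha z)) -> False.
Proof.
move=> oU oV UV Ua Vb clA FA BA calpha aM avA.
have M1 : 0 < `|M| + 1 by rewrite ltr_wpDl.
have nT : normal_space (R * R)%type by exact: (@pseudometric_normal R).
(* Tietze's theorem extends the bounded function [alpha] to the plane; [|M| + 1] is a positive
   bound. *)
have [|h [hA ch _]] := continuous_bounded_extension nT clA M1 calpha.
  move=> z /aM h; rewrite (le_trans h)// (le_trans (ler_norm _))//.
  by rewrite lerDl.
pose phi z := if z \in U then unit_of (z - b)
  else cmul (cos (h z), sin (h z)) (unit_of (z - a)).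
have phiA z : A z -> phi z = unit_of (z - b).
  move=> Az; rewrite /phi; case: ifPn => // _.
  by rewrite -hA ?inE// (view_angle_unit_of (avA z Az)).
have nVb z : (~` V) z -> z - b != 0.
  by rewrite subr_eq0 => nV; apply: contra_notN nV => /eqP ->.
have nUa z : (~` U) z -> z - a != 0.
  by rewrite subr_eq0 => nU; apply: contra_notN nU => /eqP ->.
have phi0 z : phi z != 0.
  rewrite /phi; have [Uz|nUz] := pselect (U z).
    rewrite mem_set//; have [|t zt] := @is_angle_exists _ (z - b).
      by apply: nVb => Vz; have : (U `&` V) z by []; rewrite UV.
    by rewrite (unit_of_is_angle zt) cos_sin_neq0.
  rewrite memNset//; have [t zt] := is_angle_exists (nUa z nUz).
  rewrite (unit_of_is_angle zt).
  have -> : cmul (cos (h z), sin (h z)) (cos t, sin t) = (cos (h z + t), sin (h z + t)).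
    by rewrite cosD sinD /cmul; apply/pair_equal_spec; split; rewrite /=; ring.
  exact: cos_sin_neq0.
have cphi : continuous phi.
  apply/continuous_subspace_setT.
  (* Two closed sets cover the plane. Off [V] the field is [unit_of (z - b)], because points off
     both [U] and [V] lie in [A]; off [U] it is the rotated field. *)
  have -> : [set: R * R] = ~` V `|` ~` U by rewrite -setCI setIC UV setC0.
  apply: withinU_continuous; [exact: open_closedC|exact: open_closedC| |].
    have : {within ~` V, continuous (fun z => unit_of (z - b))}.
      apply: continuous_in_subspaceT => z; rewrite inE => nVz.
      apply: (for_continuous_comp (g := @unit_of R) (f := fun z : R * R => z - b)).
        exact: subr_for_continuous.
      exact/unit_of_continuous/nVb.
    apply: subspace_eq_continuous => z; rewrite inE /from_subspace => nVz.
    have [Uz|nUz] := pselect (U z); first by rewrite /phi mem_set.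
    by rewrite phiA//; apply: FA => -[].
  have : {within ~` U, continuous (fun z => cmul (cos (h z), sin (h z)) (unit_of (z - a)))}.
    apply: continuous_in_subspaceT => z; rewrite inE => nUz.
    have cu : {for z, continuous (fun z : R * R => unit_of (z - a))}.
      apply: (for_continuous_comp (g := @unit_of R) (f := fun z : R * R => z - a)).
        exact: subr_for_continuous.
      exact/unit_of_continuous/nUa.
    have c1 := for_continuous_fst cu; have c2 := for_continuous_snd cu.
    have cc : {for z, continuous (fun z => cos (h z))}.
      by apply: (for_continuous_comp (g := cos)); [exact: ch|exact: continuous_cos].
    have cs : {for z, continuous (fun z => sin (h z))}.
      by apply: (for_continuous_comp (g := sin)); [exact: ch|exact: continuous_sin].
    apply: (for_continuous_pair
      (f := fun z : R * R => cos (h z) * (unit_of (z - a)).1 - sin (h z) * (unit_of (z - a)).2)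
      (g := fun z : R * R => sin (h z) * (unit_of (z - a)).1 + cos (h z) * (unit_of (z - a)).2)).
      by apply: cvgB; exact: cvgM.
    by apply: cvgD; exact: cvgM.
  by apply: subspace_eq_continuous => z; rewrite inE /from_subspace => nUz; rewrite /phi memNset.
(* On this circle [enorm z] is at least the radius minus [enorm b], hence at least [B], so [phi] is
   the outward unit normal there. *)
apply: (@no_retraction R phi b (`|B| + enorm b + 1)) => //.
  by rewrite ltr_wpDl// addr_ge0// sqrtr_ge0.
move=> t; set z := (_, _).
have r0 : 0 < `|B| + enorm b + 1 by rewrite ltr_wpDl// addr_ge0// sqrtr_ge0.
have zb : is_angle (z - b) t.
  exists (`|B| + enorm b + 1) => //.
  by apply/pair_equal_spec; split; rewrite /= addrAC subrr add0r.
rewrite phiA ?(unit_of_is_angle zb)//; apply: BA => /=.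
have e1 : enorm (cos t, sin t) = 1 by rewrite /enorm /dot /= -!expr2 cos2Dsin2 sqrtr1.
have := cauchy_schwarz (cos t, sin t) z; rewrite e1 mul1r; apply: le_trans.
have := cauchy_schwarz (cos t, sin t) (- b); rewrite e1 mul1r enormN.
have -> : dot (cos t, sin t) z = `|B| + enorm b + 1 - dot (cos t, sin t) (- b).
  transitivity ((`|B| + enorm b + 1) * (cos t ^+ 2 + sin t ^+ 2)
      - dot (cos t, sin t) (- b)).
    by rewrite /dot /z /=; ring.
  by rewrite cos2Dsin2 mulr1.
have := ler_norm B; lra.
Qed.

(** * The theorem in the plane *)

Lemma separated_open (R : realType) (E0 E1 : set (R * R)) :
  separated E0 E1 ->
  exists U V, [/\ open U, open V, E0 `<=` U, E1 `<=` V & U `&` V = set0].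
Proof.
move=> sE.
(* The ball of doubled radius misses the other set; if two of the smaller balls met, the larger
   radius, doubled, would reach the other centre. *)
pose nb (A B : set (R * R)) := \bigcup_(x in A)
  \bigcup_(e in [set e : R | 0 < e /\ ball x (e + e) `&` B = set0]) ball x e.
have onb A B : open (nb A B).
  by apply: bigcup_open => x _; apply: bigcup_open => e [e0 _]; exact: ball_open.
have sub A B : A `&` closure B = set0 -> A `<=` nb A B.
  move=> AB x Ax; have : ~ closure B x.
    by move=> Bx; have : (A `&` closure B) x by []; rewrite AB.
  move=> /existsNP[C /not_implyP[/nbhs_ballP[e /= e0 eC] CB]].
  exists x => //; exists (e / 2); last by apply: ballxx; rewrite divr_gt0.
  split; first by rewrite divr_gt0.
  apply/seteqP; split=> // y [xy By]; apply: CB; exists y; split=> //.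
  by apply: eC; rewrite -splitr in xy.
case: sE => s1 s2; exists (nb E0 E1), (nb E1 E0); split=> //.
- exact: sub.
- by apply: sub; rewrite setIC.
apply/seteqP; split=> // z [[x E0x [e [e0 xE] xz]] [y E1y [d [d0 yE] yz]]].
have [ed|de] := leP d e.
  have : (ball x (e + e) `&` E1) y.
    split=> //; apply: (@le_ball _ _ _ (e + d)); first by rewrite lerD2l.
    by apply: ball_triangle xz _; exact: ball_sym.
  by rewrite xE.
have : (ball y (d + d) `&` E0) x.
  split=> //; apply: (@le_ball _ _ _ (d + e)); first by rewrite lerD2l ltW.
  by apply: ball_triangle yz _; exact: ball_sym.
by rewrite yE.
Qed.

Lemma unbounded_orbits_plane_connected (R : realType) (f : R * R -> R * R)
    (s : nat -> R) :
  holomorphic f -> s n @[n --> \oo] --> +oo ->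
  (forall n z, enorm z = s n -> s n.+1 <= enorm (f z)) ->
  connected (~` \bigcup_M orbits_le (@enorm R) f M).
Proof.
move=> hf soo sf; apply/connectedP => E [E0 EU sE].
have cf := holomorphic_continuous hf.
have cN := @enorm_continuous R.
have hP : hausdorff_space (R * R)%type by exact: norm_hausdorff.
have dich := min_modulus_orbits_rigid cN cf soo sf.
have [U [V [oU oV EfU EtV UV]]] := separated_open sE.
have [a Ea] := E0 false; have [b Eb] := E0 true.
have Ua := EfU _ Ea; have Vb := EtV _ Eb.
pose F := ~` (U `|` V).
have clF : closed F by apply: open_closedC; exact: openU.
have FK : F `<=` \bigcup_M orbits_le (@enorm R) f M.
  move=> z nUV; apply: contrapT => nK; apply: nUV.
  have : (~` \bigcup_M orbits_le (@enorm R) f M) z by [].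
  by rewrite EU => -[/EfU|/EtV]; [left|right].
have nK c : (E false `|` E true) c -> forall M, ~ orbits_le (@enorm R) f M c.
  by rewrite -EU => nc M cM; apply: nc; exists M.
pose good (W : set (R * R)) := closed (F `&` W) /\ open W /\
  (exists B, F `&` W `<=` [set z | enorm z <= B]) /\
  (exists2 al : R * R -> R, {within F `&` W, continuous al} &
    forall z, (F `&` W) z -> view_angle a b z (al z)).
have good_at p : F p -> exists W, [/\ good W, open W & W p].
  move=> Fp; have [t _ pt] := FK _ Fp; have [u tu du] := dich t.
  pose Z := F `&` [set z | enorm z <= u + 1].
  have cZ : compact Z.
    rewrite /Z setIC; apply: compact_closedI => //; exact: enorm_le_compact.
  have Zp : Z p.
    split=> //=; rewrite (le_trans (pt 0%N))//; lra.
  (* The component is a continuum of bounded orbits, so it has some bound [M]; rigidity at [p]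
     replaces it by [u], known in advance. *)
  have compu : connected_component Z p `<=` orbits_le (@enorm R) f u.
    have clC : closed (connected_component Z p).
      by apply: component_closed; exact: compact_closed.
    have cC : compact (connected_component Z p).
      by apply: subclosed_compact cZ _ => //; exact: connected_component_sub.
    have conC : connected (connected_component Z p) by exact: component_connected.
    have [|M CM] := continuum_orbits_bounded hP cN cf dich cC conC.
      by move=> z /connected_component_sub[/FK].
    apply: (du _ M conC CM); exists p; split=> //.
    exact: connected_component_refl.
  have [Da [al [oDa KDa cal alP]]] := orbits_le_has_angle hf (nK a (or_introl Ea) u).
  have [Db [be [oDb KDb cbe beP]]] := orbits_le_has_angle hf (nK b (or_intror Eb) u).
  pose D := Da `&` Db `&` [set z | enorm z < u + 1].
  have oD : open D.
    by apply: openI; [exact: openI|exact: open_sublevel].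
  have [|W [oW Wp cW WD]] := component_clopen_nbhs hP cZ Zp oD.
    move=> z /compu zu; split; first by split; [exact: KDa|exact: KDb].
    by rewrite /= (le_lt_trans (zu 0%N))// ltrDl.
  (* The set [D] keeps the piece off the circle of radius [u + 1] where [F] was truncated, so it is
     clopen in [F] and not only in [Z]. *)
  have FW : F `&` (W `&` D) = Z `&` W.
    apply/seteqP; split=> z; first by move=> [Fz [Wz [_ /ltW zu]]].
    by move=> zz; have zD := WD z zz; move: zz => [[Fz zu] Wz].
  have Dp : D p by apply: WD.
  exists (W `&` D); split; [|exact: openI|by []].
  split; first by rewrite FW.
  split; first exact: openI.
  split; first by exists (u + 1) => z; rewrite FW => -[[_]].
  exists (fun z => be z - al z).
    apply: continuous_in_subspaceT => z; rewrite inE => -[_ [_ [[Daz Dbz] _]]].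
    by apply: cvgB; [exact: cbe|exact: cal].
  move=> z [_ [_ [[Daz Dbz] _]]]; exists (al z); first exact: alP.
  by rewrite [al z + _]addrC subrK; exact: beP.
have good0 : good set0.
  rewrite /good setI0; split; first exact: closed0.
  split; first exact: open0.
  split; first by exists 0.
  by exists (fun=> 0) => //; exact: continuous_subspace0.
have goodU W1 W2 : good W1 -> good W2 -> good (W1 `|` W2).
  move=> [c1 [ow1 [[B1 b1] [al1 cal1 av1]]]] [c2 [ow2 [[B2 b2] [al2 cal2 av2]]]].
  (* The first argument wins on the overlap. The pieces are disjoint and closed, so the two
     arguments need not agree. *)
  have WE : F `&` (W1 `|` W2) = (F `&` W1) `|` ((F `&` W2) `&` ~` W1).
    apply/seteqP; split=> z.
      move=> [Fz W12]; have [W1z|nW1z] := pselect (W1 z); first by left.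
      by right; case: W12.
    by move=> [[Fz W1z]|[[Fz W2z] _]]; split=> //; [left|right].
  have c3 : closed ((F `&` W2) `&` ~` W1) by apply: closedI => //; exact: open_closedC.
  split; first by rewrite WE; exact: closedU.
  split; first exact: openU.
  split.
    exists (Num.max B1 B2) => z; rewrite setIUr /= le_max.
    by move=> [/b1 /= ->//|/b2 /= ->]; rewrite orbT.
  exists (fun z => if z \in W1 then al1 z else al2 z).
    rewrite WE; apply: within_continuous_glue => //; try by move=> z [].
    by apply: continuous_subspaceW cal2; exact: subIsetl.
  move=> z; rewrite WE => -[[Fz W1z]|[[Fz W2z] nW1z]].
    by rewrite mem_set//; exact: av1.
  by rewrite memNset//; exact: av2.
pose B0 : R := 2 * (enorm a + enorm b) + 1.
have cF0 : compact (F `&` [set z | enorm z <= B0]).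
  by rewrite setIC; apply: compact_closedI => //; exact: enorm_le_compact.
have [|W [cW [oW [[B1 FWB] [al cal av]]]] F0W] :=
    compact_directed_cover cF0 good0 goodU.
  by move=> z [Fz _]; exact: good_at.
(* The added 1 keeps the outer region disjoint from the part of [F] in [W], which lies within radius
   [B1]. *)
pose B := Num.max B0 B1 + 1.
(* Both the rest of [F] and the outer region have modulus at least [B0], where [dang] gives the view
   angle. *)
pose A2 := (F `&` ~` W) `|` [set z | B <= enorm z].
have clge : closed [set z : R * R | B <= enorm z].
  rewrite (_ : [set _ | _] = (@enorm R) @^-1` [set x | B <= x])//.
  by apply: closed_comp => [z _|]; [exact: cN|exact: closed_ge].
have clA2 : closed A2.
  apply: closedU => //; apply: closedI => //; exact: open_closedC.
have A2far z : A2 z -> 0 < dot (z - a) (z - b).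
  move=> A2z; apply: enormD_dot; case: A2z => [[Fz nWz]|/=].
    rewrite leNgt; apply/negP => h; apply: nWz; apply: F0W; split=> //=.
    exact: ltW.
  by apply: le_trans; rewrite /B -/B0 (@le_trans _ _ (Num.max B0 B1)) ?le_max ?lexx// lerDl.
have A2W : A2 `<=` ~` (F `&` W).
  move=> z [[Fz nWz] [_ /nWz]//|/= zB /FWB /= zB1].
  have := le_trans zB zB1; rewrite leNgt; apply/negP; rewrite negbK /B.
  by rewrite (@le_lt_trans _ _ (Num.max B0 B1)) ?le_max ?lexx ?orbT// ltrDl.
pose A := (F `&` W) `|` A2.
pose be z := if z \in F `&` W then al z else dang (z - a) (z - b).
have cbe : {within A, continuous be}.
  apply: within_continuous_glue => //.
  apply: continuous_in_subspaceT => z; rewrite inE => A2z.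
  by apply: dang_subr_for_continuous; rewrite gt_eqF// A2far.
have avA z : A z -> view_angle a b z (be z).
  move=> [FWz|A2z].
    by rewrite /be mem_set//; exact: av.
  by rewrite /be memNset; [exact/view_angle_dang/A2far|exact: A2W].
have [M beM] : exists M : R, forall z, A z -> `|be z| <= M.
  have cFW : compact (F `&` W).
    by apply: subclosed_compact cW (@enorm_le_compact _ B1) FWB.
  have := compact_bounded (continuous_compact cal cFW).
  move=> [M [_ /(_ (M + 1))]]; rewrite ltrDl ltr01 => /(_ isT) hM.
  exists (Num.max (M + 1) (pi / 2)) => z [FWz|A2z]; rewrite /be le_max.
    by rewrite mem_set// hM//; exists z.
  rewrite memNset; last exact: A2W.
  by apply/orP; right; rewrite ler_norml !ltW// ?atan_ltpi2// atan_gtNpi2.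
apply: (view_angle_not_separated oU oV UV Ua Vb _ _ _ cbe beM avA (B := B)).
- exact: closedU.
- move=> z Fz; have [Wz|nWz] := pselect (W z); first by left.
  by right; left.
- by move=> z zB; right; right.
Qed.

(** * Identification of R[i] with R * R *)

Definition to_plane (R : realType) (z : R[i]^o) : R * R :=
  (complex.Re z, complex.Im z).

Definition of_plane (R : realType) (p : R * R) : R[i]^o := Complex p.1 p.2.

Lemma of_planeK (R : realType) : cancel (@of_plane R) (@to_plane R).
Proof. by case. Qed.

Lemma to_planeK (R : realType) : cancel (@to_plane R) (@of_plane R).
Proof. by case. Qed.

Lemma norm_enorm (R : realType) (z : R[i]^o) : `|z| = (enorm (to_plane z))%:C%C.
Proof. by case: z => x y; rewrite normc_def /enorm /dot /= -!expr2. Qed.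

Lemma enorm_le_l1 (R : realType) (p : R * R) : enorm p <= l1 p.
Proof.
rewrite -[leRHS]ger0_norm ?l1_ge0// -sqrtr_sqr.
rewrite ler_sqrt ?sqr_ge0// /dot /l1 -!expr2 sqrrD !real_normK ?num_real//.
by rewrite addrAC lerDl mulrn_wge0// mulr_ge0.
Qed.

Lemma l1_le_enorm (R : realType) (p : R * R) : l1 p <= 2 * enorm p.
Proof.
have h1 : `|p.1| <= enorm p.
  by rewrite -sqrtr_sqr ler_sqrt ?dot_ge0// /dot -!expr2 lerDl sqr_ge0.
have h2 : `|p.2| <= enorm p.
  by rewrite -sqrtr_sqr ler_sqrt ?dot_ge0// /dot -!expr2 lerDr sqr_ge0.
rewrite /l1; lra.
Qed.

Lemma of_plane_continuous (R : realType) : continuous (@of_plane R).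
Proof.
move=> p; apply/cvgrPdist_lt => e e0.
have [er e0'] : e = (complex.Re e)%:C%C /\ 0 < complex.Re e.
  by case: e e0 => a b; rewrite ltcE /= => /andP[/eqP b0 a0]; split; rewrite // b0.
rewrite er.
have cl : {for p, continuous (fun q : R * R => l1 (p - q))}.
  apply: (for_continuous_comp (g := @l1 R) (f := fun q : R * R => p - q)).
    by apply: cvgB; [exact: cvg_cst|exact: cvg_id].
  exact: l1_continuous.
rewrite /prop_for /continuous_at subrr {2}/l1 normr0 addr0 in cl.
apply: filterS (cvgr_lt _ cl _ e0') => q pq.
rewrite norm_enorm ltcR (le_lt_trans _ pq)//.
have -> : to_plane (of_plane p - of_plane q) = p - q by [].
exact: enorm_le_l1.
Qed.

Lemma entire_holomorphic (R : realType) (f : R[i]^o -> R[i]^o) :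
  entire f -> holomorphic (fun p => to_plane (f (of_plane p))).
Proof.
move=> fE p; exists (to_plane ('D_1 f (of_plane p))) => e e0.
(* Half of [e] pays for the factor 2 in [l1_le_enorm]. *)
have e2 : 0 < (e / 2)%:C%C :> R[i] by rewrite ltcR divr_gt0.
have [d d0 fd] := derivable_expansion (fE (of_plane p)) e2.
have [dr d0'] : d = (complex.Re d)%:C%C /\ 0 < complex.Re d.
  by case: d d0 {fd} => a b; rewrite ltcE /= => /andP[/eqP b0 a0]; split; rewrite // b0.
exists (complex.Re d) => // h hd.
have := fd (of_plane h).
rewrite (norm_enorm (of_plane h)) of_planeK dr lecR => /(_ (le_trans (enorm_le_l1 h) hd)).
rewrite norm_enorm -rmorphM /= lecR.
have -> : of_plane p + of_plane h = of_plane (p + h) by [].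
set u := (X in enorm (to_plane X)).
have -> : to_plane (f (of_plane (p + h))) - to_plane (f (of_plane p)) -
    cmul (to_plane ('D_1 f (of_plane p))) h = to_plane u.
  rewrite /u; case: ('D_1 f (of_plane p)) => a b.
  case: (f (of_plane (p + h))) => ? ?; case: (f (of_plane p)) => ? ?.
  by apply/pair_equal_spec; split; rewrite /= ?[b * _ + _]addrC.
move=> hu; rewrite (le_trans (l1_le_enorm _))//.
have := enorm_le_l1 h => h1.
have := ler_wpM2l (ltW e0) h1; lra.
Qed.

Lemma iter_to_plane (R : realType) (f : R[i]^o -> R[i]^o) n z :
  iter n (fun p => to_plane (f (of_plane p))) (to_plane z) = to_plane (iter n f z).
Proof. by elim: n => //= n ->; rewrite to_planeK. Qed.

Lemma unbounded_orbits_plane (R : realType) (f : R[i]^o -> R[i]^o) :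
  unbounded_orbits f = @of_plane R @` (~` \bigcup_M orbits_le (@enorm R)
    (fun p => to_plane (f (of_plane p))) M).
Proof.
have bnd z : bounded_fun (fun n => iter n f z) <->
    exists M, orbits_le (@enorm R) (fun p => to_plane (f (of_plane p))) M (to_plane z).
  split=> [[M [Mr hM]]|[M hM]].
    (* The bound in [bounded_fun] is a real element of [R[i]], and only strictly larger values are
       guaranteed to work. *)
    exists (complex.Re M + 1) => n; rewrite iter_to_plane -lecR -norm_enorm.
    apply: hM => //.
    case: M Mr => a b; rewrite complex_real => /eqP /= ->.
    by rewrite ltcR ltrDl.
  exists M%:C%C; split; first by rewrite complex_real.
  move=> x Mx n _ /=; rewrite norm_enorm (le_trans _ (ltW Mx))// lecR.
  by rewrite -iter_to_plane.
apply/seteqP; split=> [z uz|_ [p np <-] bz].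
  exists (to_plane z); last by rewrite to_planeK.
  by move=> [M _ zM]; apply: uz; apply/bnd; exists M.
have /bnd[M] := bz; rewrite of_planeK => pM.
by apply: np; exists M.
Qed.

Theorem theorem1p2 (R : realType) (f : R[i]^o -> R[i]^o)
  (hf : transcendental_entire f)
  (hm : exists2 r : R, 0 < r &
    iter n (min_modulus f) r @[n --> \oo] --> +oo) :
  connected (unbounded_orbits f).
Proof.
case: hf => fE _; case: hm => r r0 hr.
rewrite unbounded_orbits_plane; apply: connected_continuous_connected.
  (* The levels [s n] are the iterates of [min_modulus f] at [r], so [s n.+1] bounds the modulus of
     [f] from below on the circle of radius [s n]. *)
  apply: (unbounded_orbits_plane_connected (entire_holomorphic fE) hr).
  move=> n z zn; rewrite iterS; apply: ge_inf.
    by exists 0 => _ [w _ <-]; rewrite norm_enorm /= sqrtr_ge0.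
  exists (of_plane z); first by rewrite /= norm_enorm of_planeK zn.
  by rewrite norm_enorm.
exact/continuous_subspaceT/of_plane_continuous.
Qed.
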